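(* Let $X$ and $Y$ be sequentially Prohorov completely regular spaces and let $T$ be a topological space. Suppose that the mappings $t\mapsto\mu_t\in\mathcal{P}_r(X)$ and $t\mapsto\nu_t\in\mathcal{P}_r(Y)$ on $T$ are sequentially continuous (with respect to the weak topologies) and that $(t,x,y)\mapsto h_t(x,y)$, $T\times X\times Y\to[0,+\infty)$, is a continuous function. Suppose also that for every $t\in T$ there exist nonnegative Borel functions $a_t\in L^1(\mu_t)$ and $b_t\in L^1(\nu_t)$ such that $$h_t(x,y)\le a_t(x)+b_t(y),\qquad \lim_{R\to+\infty}\sup_{t\in T}\Bigl(\int_{\{a_t\ge R\}}a_t\,d\mu_t+\int_{\{b_t\ge R\}}b_t\,d\nu_t\Bigr)=0.$$ Then the function $t\mapsto K_{h_t}(\mu_t,\nu_t)$ is sequentially continuous.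
   Context: Completely regular spaces are Hausdorff. $\mathcal{P}_r(Z)$ is the set of Radon probability measures on $Z$: Borel probability measures $\mu$ such that for every Borel set $B$ and $\varepsilon>0$ there is a compact set $K\subset B$ with $\mu(B\setminus K)<\varepsilon$. It carries the weak topology, generated by the integrals of bounded continuous functions. A set $\mathcal{M}$ of such measures is uniformly tight if for every $\varepsilon>0$ there is a compact set $K\subset Z$ with $\mu(Z\setminus K)<\varepsilon$ for all $\mu\in\mathcal{M}$. A completely regular space is sequentially Prohorov if every sequence of Radon probability measures on it weakly converging to a Radon measure is uniformly tight. $\Pi(\mu,\nu)$ is the set of Radon probability measures $\sigma$ on $X\times Y$ with $\sigma(A\times Y)=\mu(A)$ and $\sigma(X\times B)=\nu(B)$ for all Borel $A\subset X$, $B\subset Y$. For a nonnegative Borel function $h$ on $X\times Y$, $K_h(\mu,\nu)=\inf_{\sigma\in\Pi(\mu,\nu)}\int h\,d\sigma$. *)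

(* Defs.v *)
From HB Require Import structures.
From mathcomp Require Import all_boot all_order all_algebra.
From mathcomp Require Import all_classical all_reals all_analysis.

Set Implicit Arguments.
Unset Strict Implicit.
Unset Printing Implicit Defensive.

Import Order.TTheory GRing.Theory Num.Theory.
Import numFieldNormedType.Exports.

Local Open Scope classical_set_scope.
Local Open Scope ring_scope.

(* The library's [completely_regular_space] does not include separation. *)
Definition completely_regular_hausdorff (X : topologicalType) : Prop :=
  completely_regular_space X /\ hausdorff_space X.

Definition sequentially_continuous (S Z : topologicalType) (f : S -> Z) : Prop :=
  forall (u : nat -> S) (s : S), u @ \oo --> s -> f \o u @ \oo --> f s.

HB.instance Definition _ (X Y : ptopologicalType) := Pointed.on (X * Y)%type.

(* For a product space, [borel (X * Y)] is generated by the open sets of the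
   product topology; it may be strictly larger than the product of the Borel
   sigma-algebras of [X] and [Y]. *)
Notation borel X := (g_sigma_algebraType (@open X)).

Section RadonProbability.
Context {R : realType} {Z : ptopologicalType}.

Definition radon (mu : probability (borel Z) R) : Prop :=
  forall B : set (borel Z), measurable B -> forall e : R, 0 < e ->
    exists K : set Z, [/\ compact K, K `<=` B & (mu (B `\` K) < e%:E)%E].

Record radon_probability : Type := RadonProbability {
  radon_measure :> probability (borel Z) R;
  radon_measureP : radon radon_measure }.

HB.instance Definition _ := gen_eqMixin radon_probability.
HB.instance Definition _ := gen_choiceMixin radon_probability.

Definition bounded_continuous : Type :=
  {f : Z -> R | continuous f /\ bounded_fun f}.

Definition radon_integrals (mu : radon_probability) :
    {ptws bounded_continuous -> R} :=
  fun f => \int[mu]_x sval f x.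

(* The initial topology of [radon_integrals] is the coarsest one for which
   every [mu |-> \int[mu]_x f x], [f] bounded continuous, is continuous. *)
HB.instance Definition _ :=
  Topological.copy radon_probability (initial_topology radon_integrals).

Definition uniformly_tight (M : set radon_probability) : Prop :=
  forall e : R, 0 < e ->
    exists2 K : set Z, compact K & forall mu, M mu -> (mu (~` K) < e%:E)%E.

End RadonProbability.

Arguments radon_probability R Z : clear implicits.

Definition sequentially_prohorov (R : realType) (Z : ptopologicalType) : Prop :=
  forall (u : nat -> radon_probability R Z) (mu : radon_probability R Z),
    u @ \oo --> mu -> uniformly_tight (range u).

Section Kantorovich.
Context {R : realType} {X Y : ptopologicalType}.

Definition couplings (mu : radon_probability R X) (nu : radon_probability R Y) :
    set (radon_probability R (X * Y)%type) :=
  [set sigma |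
    (forall A : set (borel X), measurable A -> sigma (A `*` [set: Y]) = mu A) /\
    (forall B : set (borel Y), measurable B -> sigma ([set: X] `*` B) = nu B)].

Definition kantorovich (h : X * Y -> R)
    (mu : radon_probability R X) (nu : radon_probability R Y) : \bar R :=
  ereal_inf [set (\int[sigma]_z (h z)%:E)%E | sigma in couplings mu nu].

End Kantorovich.

(* Main.v *)
(** A coupling of two marginals is transferred to nearby marginals by hand, which
    gives upper and lower semicontinuity at once and avoids both the compactness
    of tight families of Radon measures and Kantorovich duality.

    Let [t_n --> t].  By the Prohorov property all the marginals live, up to
    [d], on fixed compact sets [K1] and [K2], and by compactness there are
    finitely many continuous functions [phi_i] on [X] and [psi_j] on [Y], forming
    partitions of unity on [K1] and [K2], such that [h_{t'}], for [t'] near [t],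
    is constant up to [e] on each cell [{phi_i != 0} x {psi_j != 0}].  A coupling
    [sigma] of the source marginals has cell masses
    [p_ij = int phi_i(x) psi_j(y) dsigma].  Weak convergence says that the
    masses of the [phi_i] and [psi_j] under source and target marginals are
    close, so slightly smaller cell masses [q_ij] are available for the target
    marginals [mu], [nu]: spread [q_ij] over the cell as the product of the
    normalised measures [phi_i mu] and [psi_j nu], and couple the little mass
    that is missing independently.  On the cells the cost is that of [sigma] up
    to [2 e]; on the rest it is small by uniform integrability of [a_t] and
    [b_t].

    The product of two Radon measures has to be built on the Borel sets of the
    product topology, where it is again Radon. *)
Require Import Defs.
From HB Require Import structures.
From mathcomp Require Import all_boot all_order all_algebra finmap.
From mathcomp Require Import all_classical all_reals all_analysis.
From mathcomp Require Import measurable_realfun giry ring lra.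

Set Implicit Arguments.
Unset Strict Implicit.
Unset Printing Implicit Defensive.

Import Order.TTheory GRing.Theory Num.Theory.
Import numFieldNormedType.Exports.

Local Open Scope classical_set_scope.
Local Open Scope ring_scope.

(** * Borel sets and sections of Radon measures *)

Lemma open_borel (Z : ptopologicalType) (U : set (borel Z)) :
  open (U : set Z) -> measurable U.
Proof. exact: sub_sigma_algebra. Qed.

Lemma closed_borel (Z : ptopologicalType) (F : set (borel Z)) :
  closed (F : set Z) -> measurable F.
Proof.
move=> cF; rewrite -(setCK F); apply: measurableC; apply: open_borel.
exact: closed_openC.
Qed.

Lemma compact_borel (Z : ptopologicalType) (K : set (borel Z)) :
  hausdorff_space Z -> compact (K : set Z) -> measurable K.
Proof. by move=> hZ cK; apply: closed_borel; exact: compact_closed. Qed.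

Lemma continuous_borel (Z W : ptopologicalType) (f : Z -> W) :
  continuous f -> measurable_fun [set: borel Z] (f : borel Z -> borel W).
Proof.
move=> cf; apply: (@measurability _ _ (borel Z) (borel W) setT f (@open W)) => //.
move=> _ [U oU <-]; rewrite setTI; apply: open_borel.
exact: open_comp.
Qed.

Lemma continuous_borel_real (R : realType) (Z : ptopologicalType) (f : Z -> R) :
  continuous f -> measurable_fun [set: borel Z] f.
Proof.
move=> cf; apply: (measurability (@RGenOInfty.G R)).
  exact: RGenOInfty.measurableE.
move=> _ [_ [r ->] <-]; rewrite setTI; apply: open_borel.
by apply: open_comp => //; exact: open_gt.
Qed.

Lemma lsc_borel (R : realType) (Z : ptopologicalType) (f : borel Z -> \bar R) :
  (forall r : R, open ([set z | (r%:E < f z)%E] : set Z)) ->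
  measurable_fun [set: borel Z] f.
Proof.
move=> of_; apply: (measurability (@ErealGenOInfty.G R)).
  exact: ErealGenOInfty.measurableE.
move=> _ [_ [r ->] <-]; rewrite setTI; apply: open_borel.
rewrite (_ : _ @^-1` _ = [set z | (r%:E < f z)%E])//.
by apply/seteqP; split=> z /=; rewrite in_itv/= andbT.
Qed.

Lemma fst_borel (X Y : ptopologicalType) :
  measurable_fun [set: borel (X * Y)%type] (fst : borel (X * Y)%type -> borel X).
Proof. by apply: continuous_borel => z; exact: cvg_fst. Qed.

Lemma snd_borel (X Y : ptopologicalType) :
  measurable_fun [set: borel (X * Y)%type] (snd : borel (X * Y)%type -> borel Y).
Proof. by apply: continuous_borel => z; exact: cvg_snd. Qed.

Lemma hausdorff_prod (X Y : topologicalType) :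
  hausdorff_space X -> hausdorff_space Y -> hausdorff_space (X * Y)%type.
Proof.
move=> hX hY [x y] [x' y'] clxy; congr pair.
- apply: hX => A B Ax Bx'; have [||[u v] [Au Bu]] := clxy (fst @^-1` A) (fst @^-1` B).
  + by apply: (@cvg_fst _ _ (nbhs x) (nbhs y)).
  + by apply: (@cvg_fst _ _ (nbhs x') (nbhs y')).
  by exists u.
- apply: hY => A B Ay By'; have [||[u v] [Av Bv]] := clxy (snd @^-1` A) (snd @^-1` B).
  + by apply: (@cvg_snd _ _ (nbhs x) (nbhs y)).
  + by apply: (@cvg_snd _ _ (nbhs x') (nbhs y')).
  by exists v.
Qed.

Lemma continuous_pair (X Y : topologicalType) (x : X) :
  continuous (fun y : Y => (x, y)).
Proof.
move=> y; apply: (cvg_pair (f := cst x) (g := id)); first exact: cvg_cst.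
exact: cvg_id.
Qed.

Lemma pair_borel (X Y : ptopologicalType) (x : X) :
  measurable_fun [set: borel Y]
    ((fun y => (x, y)) : borel Y -> borel (X * Y)%type).
Proof. by apply: continuous_borel; exact: continuous_pair. Qed.

Lemma section_measurable (X Y : ptopologicalType) (x : X)
    (S : set (borel (X * Y)%type)) :
  measurable S -> measurable (pair x @^-1` S : set (borel Y)).
Proof. by move=> mS; rewrite -[X in measurable X]setTI; exact: pair_borel. Qed.

(** Tube lemma: every point of [C] has a box inside [U], and compactness of [C], used as the
    near-covering property, merges these boxes into one neighbourhood of [x]. *)
Lemma tube (X Y : topologicalType) (U : set (X * Y)) (x : X) (C : set Y) :
  open U -> compact C -> (forall y, C y -> U (x, y)) ->
  \forall x' \near x, forall y, C y -> U (x', y).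
Proof.
move=> oU /compact_near_coveringP cC CU.
apply: (cC X (nbhs x) (fun x' y => U (x', y))) => y Cy.
have : nbhs (x, y) U by rewrite nbhsE; exists U => //; split=> //; exact: CU.
case=> -[A B] /= [Ax By] AB.
by exists (B, A) => //= -[y' x'] /= [By' Ax']; exact: (AB (x', y')).
Qed.

(** [P] is finite, so a compact subset losing less than [P U - r] still has mass above [r]. *)
Lemma radon_inner (R : realType) (Z : ptopologicalType)
    (P : radon_probability R Z) (U : set (borel Z)) (r : R) :
  hausdorff_space Z -> measurable U -> (r%:E < P U)%E ->
  exists K : set Z, [/\ compact K, K `<=` U & (r%:E < P K)%E].
Proof.
move=> hZ mU rU.
have fin A : measurable A -> exists a, P A = a%:E.
  by move=> mA; exists (fine (P A)); rewrite fineK// fin_num_measure.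
have [u uE] := fin _ mU; move: rU; rewrite uE lte_fin => ru.
have e0 : 0 < u - r by rewrite subr_gt0.
have [K [cK KU UK]] := radon_measureP P mU e0.
exists K; split => //.
have mK : measurable (K : set (borel Z)) by exact: compact_borel.
have [k kE] := fin _ mK.
have UKE : P (U `\` K) = (P U - P K)%E.
  by rewrite measureD ?setIidr// ltey_eq fin_num_measure.
by move: UK; rewrite UKE uE kE -EFinB !lte_fin; lra.
Qed.

(* Inner regularity of [nu] makes [x |-> nu (U_x)] lower semicontinuous. *)
Lemma open_section_gt (R : realType) (X Y : ptopologicalType)
    (nu : radon_probability R Y) (U : set (X * Y)) (r : R) :
  hausdorff_space Y -> open U ->
  open [set x | (r%:E < nu (pair x @^-1` U))%E].
Proof.
move=> hY oU; rewrite openE => x /= rU.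
have oUx x' : open (pair x' @^-1` U).
  by apply: open_comp => // y _; exact: continuous_pair.
have [C [cC CU rC]] := radon_inner hY (open_borel (oUx x)) rU.
apply: filterS (tube oU cC CU) => x' CU' /=.
apply: lt_le_trans rC _; apply: le_measure; rewrite ?inE//.
- exact: compact_borel.
- by apply: open_borel; exact: (oUx x').
Qed.

(** Pi-lambda argument run on open sets and not on rectangles, which need not generate
    [borel (X * Y)]. On open sets the section mass is lower semicontinuous; complements and
    countable disjoint unions preserve measurability. *)
Lemma measurable_section (R : realType) (X Y : ptopologicalType)
    (nu : radon_probability R Y) (B : set (borel (X * Y)%type)) :
  hausdorff_space Y -> measurable B ->
  measurable_fun [set: borel X] (fun x => nu (pair x @^-1` B)).
Proof.
move=> hY.
apply: (@dynkin_induction _ (borel (X * Y)%type) (@open (X * Y)%type)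
  [set B | measurable_fun [set: borel X] (fun x => nu (pair x @^-1` B))]) => //.
- by move=> U V; exact: openI.
- rewrite /= (_ : (fun _ => _) = cst 1%E)//; apply/funext => x.
  by rewrite preimage_setT probability_setT.
- by move=> U oU; apply: lsc_borel => r; exact: open_section_gt.
- move=> S mS /= mphi.
  rewrite (_ : (fun _ => _) = (fun x => 1 - nu (pair x @^-1` S))%E).
    exact: emeasurable_funB.
  by apply/funext => x; rewrite preimage_setC probability_setC//; exact: section_measurable.
- move=> F mF tF /= mphi.
  rewrite (_ : (fun _ => _) = (fun x => \sum_(0 <= k <oo) nu (pair x @^-1` F k))%E).
    exact: ge0_emeasurable_sum.
  apply/funext => x; rewrite preimage_bigcup measure_semi_bigcup//.
  + by move=> i; exact: section_measurable.
  + by move=> i j _ _ [y [Fi Fj]]; apply: tF => //; exists (x, y).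
  + by apply: bigcup_measurable => i _; exact: section_measurable.
Qed.

(** * Radon measures from inner regularity on open sets *)

Section RadonCriterion.
Context {R : realType} {Z : ptopologicalType}.
Variable P : probability (borel Z) R.
Hypothesis hZ : hausdorff_space Z.

Definition inner_regular (B : set (borel Z)) : Prop :=
  measurable B /\ forall e : R, 0 < e ->
    exists K : set Z, [/\ compact K, K `<=` B & (P (B `\` K) < e%:E)%E].

(** The [n]-th set is allowed the error [e / 2 ^ n.+1], and these errors sum to [e]. *)
Let compact_approx (A : (set (borel Z))^nat) (e : R) :
  (forall n, inner_regular (A n)) -> 0 < e ->
  exists K : (set Z)^nat, [/\ forall n, compact (K n), forall n, K n `<=` A n,
    forall n, measurable (A n `\` K n) &
    (P (\bigcup_n (A n `\` K n)) <= e%:E)%E].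
Proof.
move=> iA e0.
have en0 n : 0 < e / (2 ^ n.+1)%:R by rewrite divr_gt0// ltr0n expn_gt0.
have /choice[K KP] n : exists K : set Z, [/\ compact K, K `<=` A n &
    (P (A n `\` K) < (e / (2 ^ n.+1)%:R)%:E)%E] by have [_ /(_ _ (en0 n))] := iA n.
have mAK n : measurable (A n `\` K n).
  apply: measurableD; first by have [] := iA n.
  by have [cK _ _] := KP n; exact: compact_borel.
exists K; split => //; try by move=> n; have [] := KP n.
apply: le_trans (epsilon_trick0 xpredT (ltW e0)).
apply: le_trans (measure_sigma_subadditive P mAK _ (@subset_refl _ _)) _.
  exact: bigcup_measurable.
by apply: lee_nneseries => // n _; have [_ _ /ltW] := KP n.
Qed.

(** A countable union of compact sets need not be compact, so only finitely many are kept. Half of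
    [e] pays for the compact approximations, the other half for the part of the union beyond the
    first [N] sets, which decreases to the empty set. *)
Lemma inner_regular_bigcup (A : (set (borel Z))^nat) :
  (forall n, inner_regular (A n)) -> inner_regular (\bigcup_n A n).
Proof.
move=> iA; have mA n : measurable (A n) by have [] := iA n.
have mU : measurable (\bigcup_n A n) by exact: bigcup_measurable.
split=> // e e0; have e20 : 0 < e / 2 by rewrite divr_gt0.
have [K [cK KA mAK PAK]] := compact_approx iA e20.
pose B n := \bigcup_n A n `\` \big[setU/set0]_(i < n) A i.
have mB n : measurable (B n).
  by apply: measurableD => //; exact: bigsetU_measurable.
have : P \o B @ \oo --> P (\bigcap_n B n).
  apply: nonincreasing_cvg_mu => //.
  - by rewrite ltey_eq fin_num_measure.
  - exact: bigcap_measurable.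
  - by move=> m n mn; apply/subsetPset; apply: setDS; exact: subset_bigsetU.
have -> : \bigcap_n B n = set0.
  rewrite -subset0 => z Bz; have [[i _ Aiz] _] := Bz 0%N I.
  have [_] := Bz i.+1 I; apply; rewrite big_ord_recr/=; by right.
rewrite measure0 => /(_ [set y | (y < (e / 2)%:E)%E]).
case=> [|N _ /(_ N (leqnn N)) /= BN].
  by apply: open_nbhs_nbhs; split; [exact: open_ereal_lt_ereal|rewrite /= lte_fin].
exists (\big[setU/set0]_(i < N) K i); split.
- exact: bigsetU_compact.
- by move=> z; rewrite -bigcup_mkord => -[i _ /KA Aiz]; exists i.
have mE : measurable (\bigcup_n (A n `\` K n)) by exact: bigcup_measurable.
apply: (@le_lt_trans _ _ (P (B N `|` \bigcup_n (A n `\` K n)))).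
  apply: le_measure; rewrite ?inE.
  - apply: measurableD => //; apply: bigsetU_measurable => i _.
    exact: compact_borel.
  - exact: measurableU.
  move=> z [Uz KNz]; have [BNz|] := pselect (B N z); first by left.
  move/not_andP => [//|/contrapT]; rewrite -bigcup_mkord => -[i iN Aiz].
  right; exists i => //; split => // Kiz; apply: KNz.
  by rewrite -bigcup_mkord; exists i.
apply: le_lt_trans (measureU2 P (mB N) mE) _.
by rewrite [e]splitr EFinD; apply: lte_leD => //; rewrite fin_num_measure.
Qed.

(** The intersection of the [K n] is closed in [K 0], hence compact, and each point it loses is
    already lost at some stage [n]. *)
Lemma inner_regular_bigcap (A : (set (borel Z))^nat) :
  (forall n, inner_regular (A n)) -> inner_regular (\bigcap_n A n).
Proof.
move=> iA; have mA n : measurable (A n) by have [] := iA n.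
have mI : measurable (\bigcap_n A n) by exact: bigcap_measurable.
split=> // e e0; have e20 : 0 < e / 2 by rewrite divr_gt0.
have [K [cK KA mAK PAK]] := compact_approx iA e20.
have clK n : closed (K n) by exact: compact_closed.
exists (\bigcap_n K n); split.
- apply: (subclosed_compact _ (cK 0%N)); first exact: closed_bigI.
  by move=> z; apply.
- by move=> z Kz n _; exact: KA (Kz n I).
apply: (@le_lt_trans _ _ (e / 2)%:E); last by rewrite lte_fin; lra.
apply: le_trans PAK; apply: le_measure; rewrite ?inE.
- apply: measurableD => //; apply: bigcap_measurable => // n _.
  exact: compact_borel.
- exact: bigcup_measurable.
move=> z [Az /existsNP[n /not_implyP[_ Knz]]].
by exists n => //; split => //; exact: Az.
Qed.

(** Tightness makes every closed set inner regular, by intersecting it with a large compact set. A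
    sigma-algebra argument then carries inner regularity from open and closed sets to all Borel
    sets. *)
Lemma radon_criterion :
  (forall e : R, 0 < e -> exists2 K : set Z, compact K & (P (~` K) < e%:E)%E) ->
  (forall U, open U -> inner_regular U) -> radon P.
Proof.
move=> tight inner_open.
have inner_closed F : closed F -> inner_regular F.
  move=> cF; split=> [|e e0]; first exact: closed_borel.
  have [K cK PK] := tight _ e0; exists (K `&` F); split.
  - exact: compact_closedI.
  - by move=> z [].
  apply: le_lt_trans PK; apply: le_measure; rewrite ?inE.
  - apply: measurableD; first exact: closed_borel.
    by apply: measurableI; [exact: compact_borel|exact: closed_borel].
  - by apply: measurableC; exact: compact_borel.
  by move=> z [Fz /not_andP[]].
(* Inner regularity does not visibly pass to complements, so it is required of a set and of its
   complement together. Countable unions then need both the union and the intersection lemma. *)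
pose H := [set B : set (borel Z) | inner_regular B /\ inner_regular (~` B)].
have sH : sigma_algebra [set: borel Z] H.
  split.
  - by split; apply: inner_closed; rewrite ?setC0; [exact: closed0|exact: closedT].
  - by move=> A [iA iAc]; split; rewrite setTD ?setCK.
  - move=> A iA; split; first by apply: inner_regular_bigcup => n; have [] := iA n.
    by rewrite setC_bigcup; apply: inner_regular_bigcap => n; have [] := iA n.
have oH : @open Z `<=` H.
  move=> U oU; split; first exact: inner_open.
  by apply: inner_closed; exact: open_closedC.
by move=> B mB; have [[_]] := smallest_sub sH oH mB.
Qed.

End RadonCriterion.

(** * Product of Radon probability measures *)

(** Serves to package a measure of total mass one as a [probability]: the normalisation divides by
    one. *)
Lemma mnormalize1E d (T : measurableType d) (R : realType)
    (m : {measure set T -> \bar R}) (P : probability T R) (A : set T) :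
  m [set: T] = 1%E -> mnormalize m P A = m A.
Proof. by move=> m1; rewrite /mnormalize m1/= onee_eq0/= invr1 mule1. Qed.

(* [mu \x nu] of the library lives on the product of the Borel sigma-algebras,
   hence the separate construction on [borel (X * Y)]. *)
Section ProductProbability.
Context {R : realType} {X Y : ptopologicalType}.
Variables (mu : radon_probability R X) (nu : radon_probability R Y).
Hypothesis hY : hausdorff_space Y.

(** The image of [nu] under [y |-> (x, y)], that is, the product of the Dirac mass at [x] with [nu].
    The average of these measures over [mu] is the product measure. *)
Let kernel (x : borel X) : giry (borel (X * Y)%type) R :=
  giry_map (@pair_borel X Y x) (nu : giry (borel Y) R).

Let measurable_kernel : measurable_fun [set: borel X] kernel.
Proof.
by apply: measurable_giry_codensity => // B mB; exact: measurable_section.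
Qed.

Let pi0 : giry (borel (X * Y)%type) R :=
  giry_bind (mu : giry (borel X) R) measurable_kernel.

Lemma product_probability_exists : exists P : probability (borel (X * Y)%type) R,
  forall B, measurable B -> P B = (\int[mu]_x nu (pair x @^-1` B))%E.
Proof.
have pi0E B : measurable B -> pi0 B = (\int[mu]_x nu (pair x @^-1` B))%E.
  move=> mB.
  transitivity (giry_int (giry_map measurable_kernel (mu : giry (borel X) R))
    (giry_ev ^~ B)) => //.
  by rewrite giry_int_map//; exact: measurable_giry_ev.
have pi0T : pi0 [set: borel (X * Y)%type] = 1%E.
  rewrite pi0E//.
  under eq_integral do rewrite preimage_setT probability_setT.
  by rewrite integral_cst// mul1e; exact: probability_setT.
exists (mnormalize pi0 (dirac point)) => B mB; rewrite -pi0E//.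
exact: mnormalize1E.
Qed.
End ProductProbability.

Lemma radon_tight (R : realType) (Z : ptopologicalType)
    (P : radon_probability R Z) (e : R) : 0 < e ->
  exists2 K : set Z, compact K & (P (~` K) < e%:E)%E.
Proof.
move=> e0; have [K [cK _]] := radon_measureP P measurableT e0.
by rewrite setTD; exists K.
Qed.

(* [F] is found by applying the covering property of [K] to the filter of tails
   of the directed family of compact subsets of [U]. *)
Lemma compact_subset_sections (R : realType) (X Y : ptopologicalType)
    (nu : radon_probability R Y) (U : set (X * Y)) (K : set X) (r : R) :
  hausdorff_space X -> hausdorff_space Y -> regular_space X ->
  open U -> compact K -> (forall x, K x -> (r%:E < nu (pair x @^-1` U))%E) ->
  exists F : set (X * Y), [/\ compact F, F `<=` U &
    forall x, K x -> (r%:E < nu (pair x @^-1` F))%E].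
Proof.
move=> hX hY rX oU cK rK.
pose D := [set F : set (X * Y) | compact F /\ F `<=` U].
pose B (F : set (X * Y)) := [set G | D G /\ F `<=` G].
have FF : Filter (filter_from D B).
  apply: filter_from_filter; first by exists set0; split => //; exact: compact0.
  move=> F G [cF FU] [cG GU]; exists (F `|` G).
    by split; [exact: compactU|rewrite subUset].
  by move=> H [DH]; rewrite subUset => -[FH GH].
have cK' : near_covering_within K.
  exact/near_covering_withinP/compact_near_coveringP.
have /(_ _)[] := cK' _ _ (fun F x => (r%:E < nu (pair x @^-1` F))%E) FF.
  move=> x Kx; have oUx : open (pair x @^-1` U).
    by apply: open_comp => // y _; exact: continuous_pair.
  have [C [cC CU rC]] := radon_inner hY (open_borel oUx) (rK _ Kx).
  (* Regularity shrinks the tube to a [V] whose closure stays inside it; the product of [C] with the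
     part of [K] in that closure is then compact and contained in [U]. *)
  have [V Vx VU] := rX _ _ (tube oU cC CU).
  exists (V, B ((K `&` closure V) `*` C)).
    split => //=; exists ((K `&` closure V) `*` C) => //; split.
      by apply: compact_setX => //; apply: compact_closedI => //; exact: closed_closure.
    by move=> [x' y] /= [[_ /VU]]; apply.
  move=> [x' F] /= [Vx' [[cF FU] VF]] Kx'.
  apply: lt_le_trans rC _; apply: le_measure; rewrite ?inE.
  - exact: compact_borel.
  - apply: section_measurable; apply: compact_borel => //.
    exact: hausdorff_prod.
  by move=> y Cy; apply: VF; split => //; split => //; exact: subset_closure.
(* The estimate holds on the whole tail generated by [F], and [F] belongs to its own tail. *)
move=> F [cF FU] BF; exists F; split => //.
exact: (BF F (conj (conj cF FU) (@subset_refl _ F))).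
Qed.

Lemma exists_level (R : realType) (d v : R) (n : nat) : 0 < v -> v <= n%:R * d ->
  exists2 j : nat, (j < n)%N & j%:R * d < v <= j.+1%:R * d.
Proof.
move=> v0; elim: n => [|n IHn] vn; first by move: vn; rewrite mul0r leNgt v0.
have [/IHn[j jn jv]|nv] := leP v (n%:R * d); first by exists j => //; exact: ltnW.
by exists n => //; rewrite nv.
Qed.

Section RadonProduct.
Context {R : realType} {X Y : ptopologicalType}.
Variables (mu : radon_probability R X) (nu : radon_probability R Y).
Hypotheses (hX : hausdorff_space X) (hY : hausdorff_space Y).
Hypothesis rX : regular_space X.
Variable P : probability (borel (X * Y)%type) R.
Hypothesis PE : forall B, measurable B -> P B = (\int[mu]_x nu (pair x @^-1` B))%E.

Let measurable_setXb (A : set (borel X)) (B : set (borel Y)) :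
  measurable A -> measurable B -> measurable (A `*` B : set (borel (X * Y)%type)).
Proof.
move=> mA mB; rewrite (_ : A `*` B = fst @^-1` A `&` snd @^-1` B)//; apply: measurableI.
- by rewrite -[X in measurable X]setTI; exact: fst_borel.
- by rewrite -[X in measurable X]setTI; exact: snd_borel.
Qed.

Lemma product_rectangle (A : set (borel X)) (B : set (borel Y)) :
  measurable A -> measurable B -> P (A `*` B) = (mu A * nu B)%E.
Proof.
move=> mA mB; rewrite PE; last exact: measurable_setXb.
transitivity (\int[mu]_x ((\1_A x)%:E * nu B))%E.
  apply: eq_integral => x _; rewrite indicE.
  have [xA|xA] := boolP (x \in A).
  - rewrite mul1e; congr (nu _); apply/seteqP; split=> y /=; first by case.
    by move=> By; split => //; exact: set_mem.
  - rewrite mul0e (_ : _ @^-1` _ = set0) ?measure0// -subset0 => y /= [Ax _].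
    by move/negP: xA; apply; exact: mem_set.
rewrite ge0_integralZr//; last by apply/measurable_EFinP; exact: measurable_indic.
by rewrite integral_indic// setIT.
Qed.

(* Off a small set, [x] lies in the compact [K j] inside the level set
   [nu (U_x) > j d] for the largest possible [j], so that the section of the
   compact set attached to [K j] exhausts [U_x] up to [d]. *)
Lemma product_inner_open (U : set (X * Y)) : open U -> inner_regular P U.
Proof.
move=> oU; have mU : measurable (U : set (borel (X * Y)%type)) by exact: open_borel.
split=> // e e0.
(* [N] exceeds [2 / e], so that [d = 1 / N] satisfies [2 * d < e]. Each of the [N] exceptional sets
   will have mass below [d * d], hence their union mass at most [d]. *)
pose N := (Num.truncn (2 / e)).+1.
pose d : R := N%:R^-1.
have N0 : 0 < N%:R :> R by rewrite ltr0n.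
have d0 : 0 < d by rewrite invr_gt0.
have Nd : N%:R * d = 1 by rewrite mulfV// gt_eqF.
have de : 2 * d < e.
  rewrite -(ltr_pM2r N0) -mulrA [d * _]mulrC Nd mulr1 mulrC.
  by rewrite -ltr_pdivrMr//; exact: truncnS_gt.
pose G j := [set x | ((j%:R * d)%:E < nu (pair x @^-1` U))%E].
have oG j : open (G j) by exact: open_section_gt.
have dd0 : 0 < d * d by rewrite mulr_gt0.
have /choice[K KP] j : exists K : set X, [/\ compact K, K `<=` G j &
    (mu (G j `\` K) < (d * d)%:E)%E].
  by have := radon_measureP mu (open_borel (oG j)) dd0.
have /choice[F FP] j : exists F : set (X * Y), [/\ compact F, F `<=` U &
    forall x, K j x -> ((j%:R * d)%:E < nu (pair x @^-1` F))%E].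
  have [cK KG _] := KP j.
  by apply: compact_subset_sections => // x /KG.
have cF : compact (\big[setU/set0]_(j < N) F j).
  by apply: bigsetU_compact => j _; have [] := FP j.
have hXY := hausdorff_prod hX hY.
have mFj j : measurable (F j : set (borel (X * Y)%type)).
  by apply: compact_borel => //; have [] := FP j.
set FN := \big[setU/set0]_(j < N) F j.
have mF : measurable (FN : set (borel (X * Y)%type)) by exact: compact_borel.
have FU : FN `<=` U.
  by rewrite /FN -bigcup_mkord => z [j _]; have [_ + _] := FP j; apply.
exists FN; split => //.
have mGK j : measurable (G j `\` K j : set (borel X)).
  apply: measurableD; first exact: open_borel.
  by apply: compact_borel => //; have [] := KP j.
pose bad : set X := \big[setU/set0]_(j < N) (G j `\` K j).
have mbad : measurable (bad : set (borel X)) by exact: bigsetU_measurable.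
have bad_le : (mu bad <= d%:E)%E.
  apply: le_trans (Boole_inequality mu (A := fun j => G j `\` K j) _) _ => //.
  apply: (@le_trans _ _ (\sum_(i < N) (d * d)%:E)%E).
    by apply: lee_sum => j _; have [_ _ /ltW] := KP j.
  by rewrite sumEFin sumr_const card_ord -mulr_natl mulrA Nd mul1r.
have sec_le x : (nu (pair x @^-1` (U `\` FN)) <= d%:E + (\1_bad x)%:E)%E.
  have mUx : measurable (pair x @^-1` U : set (borel Y)) by exact: section_measurable.
  have mFx : measurable (pair x @^-1` FN : set (borel Y)) by exact: section_measurable.
  have mDx : measurable (pair x @^-1` (U `\` FN) : set (borel Y)).
    by apply: section_measurable; exact: measurableD.
  have fin A : measurable A -> exists a, nu A = a%:E.
    by move=> mA; exists (fine (nu A)); rewrite fineK// fin_num_measure.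
  have [v vE] := fin _ mUx; have [w wE] := fin _ mFx.
  have DE : nu (pair x @^-1` (U `\` FN)) =
      (nu (pair x @^-1` U) - nu (pair x @^-1` FN))%E.
    rewrite [LHS](_ : _ = nu ((pair x @^-1` U) `\` (pair x @^-1` FN)))//.
    rewrite measureD ?setIidr//; first by move=> y /=; exact: FU.
    by rewrite ltey_eq fin_num_measure.
  rewrite DE vE wE indicE -EFinB -EFinD lee_fin.
  have v1 : v <= 1 by rewrite -lee_fin -vE probability_le1.
  have w0 : 0 <= w by rewrite -lee_fin -wE measure_ge0.
  have [_|xbad] := boolP (x \in bad); first by rewrite /=; lra.
  have [v0|v0] := leP v 0; first by rewrite /=; lra.
  (* The section mass [v] lies between [j * d] and [(j + 1) * d]. As [x] is not bad it lies in
     [K j], and the section of [F j] already has mass above [j * d], so less than [d] is lost. *)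
  have [|j jN /andP[jv vj]] := @exists_level R d v N v0; first by rewrite Nd.
  have Kx : K j x.
    apply: contrapT => nK; move/negP: xbad; apply; apply: mem_set. rewrite /bad -(bigcup_mkord _ (fun j => G j `\` K j)).
    by exists j => //; split => //; rewrite /G/= vE lte_fin.
  have [_ _ /(_ _ Kx) jF] := FP j.
  have : (j%:R * d) < w.
    rewrite -lte_fin -wE; apply: lt_le_trans jF _; apply: le_measure; rewrite ?inE//.
      exact: section_measurable.
    by move=> y Fy; rewrite /FN -bigcup_mkord; exists j.
  by move: vj; rewrite -natr1 mulrDl mul1r /=; lra.
rewrite PE; last exact: measurableD.
apply: (@le_lt_trans _ _ (\int[mu]_x (d%:E + (\1_bad x)%:E))%E).
  apply: ge0_le_integral => //.
  - by apply: measurable_section => //; exact: measurableD.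
  - by apply: emeasurable_funD => //; apply/measurable_EFinP; exact: measurable_indic.
rewrite ge0_integralD//; last 2 first.
- by move=> x _; rewrite lee_fin ltW.
- by apply/measurable_EFinP; exact: measurable_indic.
rewrite integral_cst// integral_indic// setIT.
rewrite [X in (_ * X)%E](_ : _ = 1%E) ?mule1; last exact: probability_setT.
apply: le_lt_trans (leeD2l _ bad_le) _.
by rewrite -EFinD lte_fin; lra.
Qed.

(** For tightness, the complement of [K1 x K2] is covered by two strips whose masses are those of
    the complements of [K1] and [K2] under the marginals. *)
Lemma product_radon : radon P.
Proof.
apply: radon_criterion; [exact: hausdorff_prod| |exact: product_inner_open].
move=> e e0; have e20 : 0 < e / 2 by lra.
have [K1 cK1 mK1] := radon_tight mu e20; have [K2 cK2 mK2] := radon_tight nu e20.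
have mK1' : measurable (~` K1 : set (borel X)).
  by apply: measurableC; exact: compact_borel.
have mK2' : measurable (~` K2 : set (borel Y)).
  by apply: measurableC; exact: compact_borel.
exists (K1 `*` K2); first exact: compact_setX.
apply: (@le_lt_trans _ _ (P ((~` K1 `*` [set: Y]) `|` ([set: X] `*` ~` K2)))).
  apply: le_measure; rewrite ?inE.
  - apply: measurableC; apply: compact_borel; first exact: hausdorff_prod.
    exact: compact_setX.
  - by apply: measurableU; apply: measurable_setXb.
  by move=> [x y] /not_andP[/= ?|/= ?]; [left|right].
apply: le_lt_trans (measureU2 P (measurable_setXb _ _) (measurable_setXb _ _)) _ => //.
rewrite [X in (X + _)%E](_ : _ = mu (~` K1) * nu setT)%E; last exact: product_rectangle.
rewrite [X in (_ + X)%E](_ : _ = mu setT * nu (~` K2))%E; last exact: product_rectangle.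
rewrite !probability_setT mul1e mule1 [e]splitr EFinD.
exact: lteD.
Qed.

End RadonProduct.

Lemma radon_product_exists (R : realType) (X Y : ptopologicalType)
    (mu : radon_probability R X) (nu : radon_probability R Y) :
  hausdorff_space X -> hausdorff_space Y -> regular_space X ->
  exists pi : radon_probability R (X * Y)%type, forall A B,
    measurable (A : set (borel X)) -> measurable (B : set (borel Y)) ->
    pi (A `*` B) = (mu A * nu B)%E.
Proof.
move=> hX hY rX; have [P PE] := product_probability_exists mu nu hY.
exists (RadonProbability (product_radon hX hY rX PE)) => A B mA mB.
exact: (product_rectangle PE).
Qed.

(** * Integration against product measures and densities *)

(** The integrand is measurable for the product of the two Borel sigma-algebras. There [pi]
    coincides with [mu \x nu], both having the same values on rectangles, and Tonelli applies. *)
Lemma integral_product (R : realType) (X Y : ptopologicalType)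
    (mu : radon_probability R X) (nu : radon_probability R Y)
    (pi : radon_probability R (X * Y)%type)
    (f : borel X -> \bar R) (g : borel Y -> \bar R) :
  (forall A B, measurable (A : set (borel X)) -> measurable (B : set (borel Y)) ->
    pi (A `*` B) = (mu A * nu B)%E) ->
  measurable_fun setT f -> (forall x, 0 <= f x)%E ->
  measurable_fun setT g -> (forall y, 0 <= g y)%E ->
  (\int[pi]_z (f z.1 * g z.2) = (\int[mu]_x f x) * \int[nu]_y g y)%E.
Proof.
move=> piE mf f0 mg g0.
(* The identity map, seen as a measurable map from the Borel sets of the product to the possibly
   smaller product sigma-algebra. *)
pose i (z : borel (X * Y)%type) : (borel X * borel Y)%type := (z.1, z.2).
have mi : measurable_fun setT i.
  by apply/measurable_fun_pairP; split; [exact: fst_borel|exact: snd_borel].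
pose F (z : (borel X * borel Y)%type) := (f z.1 * g z.2)%E.
have mF : measurable_fun setT F.
  by apply: emeasurable_funM; [exact: measurableT_comp|exact: measurableT_comp].
have F0 z : (0 <= F z)%E by rewrite mule_ge0.
transitivity (\int[pushforward pi i]_z F z)%E.
  by rewrite ge0_integral_pushforward.
transitivity (\int[(mu \x nu)%E]_z F z)%E.
  apply: eq_measure_integral => A mA _; apply/esym.
  exact: product_measure_unique.
rewrite fubini_tonelli1//= /fubini_F.
under eq_integral do rewrite /F/= ge0_integralZl//.
rewrite ge0_integralZr//.
exact: integral_ge0.
Qed.

Section Density.
Context d {T : measurableType d} {R : realType}.
Variables (m : {measure set T -> \bar R}) (w : T -> R).
Hypotheses (mw : measurable_fun setT w) (w0 : forall x, 0 <= w x).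

Definition density (A : set T) : \bar R := (\int[m]_(x in A) (w x)%:E)%E.

Let density0 : density set0 = 0%E.
Proof. exact: integral_set0. Qed.

Let density_ge0 A : (0 <= density A)%E.
Proof. by apply: integral_ge0 => x _; rewrite lee_fin. Qed.

Let density_sigma_additive : semi_sigma_additive density.
Proof.
move=> F mF tF mUF.
rewrite /density ge0_integral_bigcup//; last 2 first.
  by apply/measurable_EFinP; exact: measurable_funTS.
  by move=> x _; rewrite lee_fin.
apply: is_cvg_nneseries => n _ _.
by apply: integral_ge0 => x _; rewrite lee_fin.
Qed.

HB.instance Definition _ := isMeasure.Build _ _ _ density
  density0 density_ge0 density_sigma_additive.

Definition density_measure : {measure set T -> \bar R} := density.

Import HBNNSimple.

(** For simple functions the identity reduces to indicators of level sets; monotone convergence on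
    both sides does the rest. *)
Lemma integral_density (f : T -> \bar R) :
  measurable_fun setT f -> (forall x, 0 <= f x)%E ->
  (\int[density_measure]_x f x = \int[m]_x (f x * (w x)%:E))%E.
Proof.
rewrite /density_measure => mf f0.
pose g := nnsfun_approx measurableT mf.
have wE0 x : (0 <= (w x)%:E)%E by rewrite lee_fin.
have mwE : measurable_fun setT (EFin \o w) by exact/measurable_EFinP.
have gE (h : {nnsfun T >-> R}) :
    (\int[density]_x (h x)%:E = \int[m]_x ((h x)%:E * (w x)%:E))%E.
  have mA r : measurable (h @^-1` [set r]) by exact: measurable_sfunP.
  have mI r : measurable_fun setT (fun x => (\1_(h @^-1` [set r]) x)%:E : \bar R).
    by apply/measurable_EFinP; exact: measurable_indic.
  transitivity (\int[m]_x \sum_(r \in range h)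
      (r%:E * (\1_(h @^-1` [set r]) x)%:E * (w x)%:E))%E; last first.
    apply: eq_integral => x _; rewrite fimfunE -fsumEFin//.
    by rewrite ge0_mule_fsuml// => r; exact: nnfun_muleindic_ge0.
  rewrite integralT_nnsfun sintegralE ge0_integral_fsum//; last 2 first.
    by move=> r; apply: emeasurable_funM => //; exact: measurable_funeM.
    by move=> r x _; rewrite mule_ge0// nnfun_muleindic_ge0.
  apply: eq_fsbigr => r _.
  have [r0|r0] := ltP r 0.
    rewrite preimage_nnfun0// measure0 mule0 integral0_eq// => x _.
    by rewrite indic0 mule0 mul0e.
  under [RHS]eq_integral do rewrite -muleA.
  rewrite ge0_integralZl//; last 2 first.
    by apply: emeasurable_funM.
    by move=> x _; rewrite mule_ge0// lee_fin.
  congr (_ * _)%E.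
  transitivity (\int[m]_(x in h @^-1` [set r]) (w x)%:E)%E => //.
  rewrite integral_mkcond.
  by apply: eq_integral => x _; rewrite epatch_indic muleC.
transitivity (limn (fun n => \int[density]_x (g n x)%:E))%E.
  rewrite -monotone_convergence//.
  - by apply: eq_integral => x _; apply/esym/cvg_lim => //; exact: cvg_nnsfun_approx.
  - by move=> n; exact/measurable_EFinP.
  - by move=> n x _; rewrite lee_fin.
  - by move=> x _ p q pq; rewrite lee_fin; exact/lefP/nd_nnsfun_approx.
under eq_fun do rewrite gE.
rewrite -monotone_convergence//; last 3 first.
- by move=> n; apply: emeasurable_funM => //; exact/measurable_EFinP.
- by move=> n x _; rewrite mule_ge0// lee_fin.
- move=> x _ p q pq; apply: lee_wpmul2r => //.
  by rewrite lee_fin; exact/lefP/nd_nnsfun_approx.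
apply: eq_integral => x _; apply/cvg_lim => //.
apply: cvgeZr => //.
exact: cvg_nnsfun_approx.
Qed.
End Density.

(** * Couplings with a density *)

(** Absolute continuity of the integral of [w]: a compact set that exhausts [B] well enough for [P]
    also exhausts it for [Q]. *)
Lemma density_radon (R : realType) (Z : ptopologicalType)
    (P : radon_probability R Z) (w : borel Z -> R) (Q : probability (borel Z) R) :
  hausdorff_space Z ->
  measurable_fun setT w -> (forall z, 0 <= w z) ->
  (forall B, measurable B -> Q B = density P w B) -> radon Q.
Proof.
move=> hZ mw w0 QE B mB e e0.
have mwE (D : set (borel Z)) : measurable_fun D (EFin \o w).
  by apply: measurable_funTS; exact/measurable_EFinP.
have iw : P.-integrable setT (EFin \o w).
  apply/integrableP; split => //.
  under eq_integral do rewrite gee0_abs ?lee_fin//.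
  by rewrite -[ltLHS]/(density P w setT) -QE// probability_setT ltry.
have [d [d0 dP]] := integral_normr_continuous iw e0.
have [K [cK KB PK]] := radon_measureP P mB d0.
exists K; split => //.
have mBK : measurable (B `\` K) by apply: measurableD => //; exact: compact_borel.
have := dP _ mBK PK; rewrite /Rintegral.
under eq_integral do rewrite ger0_norm//.
rewrite -[X in fine X]/(density P w (B `\` K)) -QE// -lte_fin fineK//.
exact: fin_num_measure.
Qed.

Section MixtureCoupling.
Context {R : realType} {X Y : ptopologicalType}.
Variables (mu : radon_probability R X) (nu : radon_probability R Y).
Hypotheses (hX : hausdorff_space X) (hY : hausdorff_space Y).
Variable pi : radon_probability R (X * Y)%type.
Hypothesis piE : forall A B,
  measurable (A : set (borel X)) -> measurable (B : set (borel Y)) ->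
  pi (A `*` B) = (mu A * nu B)%E.
Variables (I : finType) (alpha : I -> borel X -> R) (beta : I -> borel Y -> R).
Hypothesis malpha : forall k, measurable_fun setT (alpha k).
Hypothesis mbeta : forall k, measurable_fun setT (beta k).
Hypothesis alpha0 : forall k x, 0 <= alpha k x.
Hypothesis beta0 : forall k y, 0 <= beta k y.
Variables (la lb : I -> R).
Hypothesis laE : forall k, (\int[mu]_x (alpha k x)%:E = (la k)%:E)%E.
Hypothesis lbE : forall k, (\int[nu]_y (beta k y)%:E = (lb k)%:E)%E.
Hypothesis alphaT : forall x, \sum_k alpha k x * lb k = 1.
Hypothesis betaT : forall y, \sum_k la k * beta k y = 1.

Let maE k : measurable_fun setT (EFin \o alpha k).
Proof. exact/measurable_EFinP. Qed.

Let mbE k : measurable_fun setT (EFin \o beta k).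
Proof. exact/measurable_EFinP. Qed.

Let aE0 k x : (0 <= (EFin \o alpha k) x)%E.
Proof. by rewrite lee_fin. Qed.

Let bE0 k y : (0 <= (EFin \o beta k) y)%E.
Proof. by rewrite lee_fin. Qed.

Let w (z : borel (X * Y)%type) : R := \sum_k alpha k z.1 * beta k z.2.

Let mab k : measurable_fun [set: borel (X * Y)%type]
  (fun z => alpha k z.1 * beta k z.2).
Proof.
apply: measurable_funM.
- exact: (measurableT_comp (malpha k) (@fst_borel X Y)).
- exact: (measurableT_comp (mbeta k) (@snd_borel X Y)).
Qed.

Let mw : measurable_fun setT w.
Proof. exact: measurable_sum. Qed.

Let w0 z : 0 <= w z.
Proof. by apply: sumr_ge0 => k _; rewrite mulr_ge0. Qed.

Let integral_w (F : borel (X * Y)%type -> \bar R) :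
  measurable_fun setT F -> (forall z, 0 <= F z)%E ->
  (\int[pi]_z (F z * (w z)%:E) =
   \sum_k \int[pi]_z (F z * (alpha k z.1 * beta k z.2)%:E))%E.
Proof.
move=> mF F0; rewrite -ge0_integral_sum//.
- apply: eq_integral => z _; rewrite /w -sumEFin ge0_sume_distrr// => k _.
  by rewrite lee_fin mulr_ge0.
- by move=> k; apply: emeasurable_funM => //; exact/measurable_EFinP.
- by move=> k z _; rewrite mule_ge0// lee_fin mulr_ge0.
Qed.

Let integral_fst (f : borel X -> \bar R) :
  measurable_fun setT f -> (forall x, 0 <= f x)%E ->
  (\int[pi]_z (f z.1 * (w z)%:E) = \int[mu]_x f x)%E.
Proof.
move=> mf f0; rewrite integral_w//; last first.
  exact: (measurableT_comp mf (@fst_borel X Y)).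
have mfa k : measurable_fun setT (fun x => f x * (alpha k x)%:E)%E.
  by apply: emeasurable_funM => //; exact/measurable_EFinP.
have fa0 k x : (0 <= f x * (alpha k x)%:E)%E by rewrite mule_ge0// lee_fin.
have lb0 k : 0 <= lb k.
  by rewrite -lee_fin -lbE; apply: integral_ge0 => y _; rewrite lee_fin.
transitivity (\sum_k \int[mu]_x (f x * (alpha k x)%:E * (lb k)%:E))%E.
  apply: eq_bigr => k _.
  have := integral_product piE (mfa k) (fa0 k) (mbE k) (bE0 k).
  rewrite lbE => E; apply: etrans (etrans E _).
    by apply: eq_integral => z _; rewrite EFinM muleA.
  by rewrite ge0_integralZr// lee_fin.
rewrite -ge0_integral_sum//.
- apply: eq_integral => x _.
  under eq_bigr do rewrite -muleA -EFinM.
  rewrite -ge0_sume_distrr; last by move=> k _; rewrite lee_fin mulr_ge0.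
  by rewrite sumEFin alphaT mule1.
- by move=> k; apply: emeasurable_funM.
- by move=> k x _; rewrite mule_ge0// lee_fin.
Qed.

Let integral_snd (g : borel Y -> \bar R) :
  measurable_fun setT g -> (forall x, 0 <= g x)%E ->
  (\int[pi]_z (g z.2 * (w z)%:E) = \int[nu]_y g y)%E.
Proof.
move=> mg g0; rewrite integral_w//; last first.
  exact: (measurableT_comp mg (@snd_borel X Y)).
have mgb k : measurable_fun setT (fun y => g y * (beta k y)%:E)%E.
  by apply: emeasurable_funM => //; exact/measurable_EFinP.
have gb0 k y : (0 <= g y * (beta k y)%:E)%E by rewrite mule_ge0// lee_fin.
have la0 k : 0 <= la k.
  by rewrite -lee_fin -laE; apply: integral_ge0 => x _; rewrite lee_fin.
transitivity (\sum_k \int[nu]_y (g y * (beta k y)%:E * (la k)%:E))%E.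
  apply: eq_bigr => k _.
  have := integral_product piE (maE k) (aE0 k) (mgb k) (gb0 k).
  rewrite laE => E; apply: etrans (etrans E _).
    by apply: eq_integral => z _; rewrite EFinM muleCA.
  by rewrite ge0_integralZr// 1?muleC// lee_fin.
rewrite -ge0_integral_sum//.
- apply: eq_integral => y _.
  under eq_bigr do rewrite -muleA -EFinM mulrC.
  rewrite -ge0_sume_distrr; last by move=> k _; rewrite lee_fin mulr_ge0.
  by rewrite sumEFin betaT mule1.
- by move=> k; apply: emeasurable_funM.
- by move=> k y _; rewrite mule_ge0// lee_fin.
Qed.

(** The density is [w]. By Tonelli, integrating out [y] leaves the factor
    [\sum_k alpha k x * lb k = 1], and integrating out [x] leaves [\sum_k la k * beta k y = 1];
    hence the marginals are [mu] and [nu]. *)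
Lemma mixture_coupling : exists2 sigma : radon_probability R (X * Y)%type,
  couplings mu nu sigma &
  forall F : borel (X * Y)%type -> \bar R,
    measurable_fun setT F -> (forall z, 0 <= F z)%E ->
    (\int[sigma]_z F z =
     \sum_k \int[pi]_z (F z * (alpha k z.1 * beta k z.2)%:E))%E.
Proof.
pose dpi := density_measure pi mw w0.
have dE (F : borel (X * Y)%type -> \bar R) : measurable_fun setT F ->
    (forall z, 0 <= F z)%E ->
    (\int[dpi]_z F z = \int[pi]_z (F z * (w z)%:E))%E.
  exact: integral_density.
have dT : dpi setT = 1%E.
  transitivity (\int[pi]_z (cst 1%E z.1 * (w z)%:E))%E.
    by apply: eq_integral => z _; rewrite mul1e.
  by rewrite (@integral_fst (cst 1%E))// integral_cst// mul1e; exact: probability_setT.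
have QE B : measurable B -> mnormalize (dpi) (dirac point) B = density pi w B.
  by move=> mB; exact: mnormalize1E.
have Qr := density_radon (hausdorff_prod hX hY) mw w0 QE.
pose sigma := RadonProbability Qr.
have sE (F : borel (X * Y)%type -> \bar R) : measurable_fun setT F ->
    (forall z, 0 <= F z)%E -> (\int[sigma]_z F z = \int[pi]_z (F z * (w z)%:E))%E.
  move=> mF F0; rewrite -dE//; apply: eq_measure_integral => B mB _.
  exact: QE.
exists sigma; last by move=> F mF F0; rewrite sE// integral_w.
split=> [A mA|B mB].
- have mAT : measurable (A `*` [set: Y] : set (borel (X * Y)%type)).
    by rewrite setXT -[X in measurable X]setTI; exact: fst_borel.
  have mA1 : measurable_fun [set: borel X] (EFin \o (\1_A : borel X -> R)).
    by apply/measurable_EFinP; exact: measurable_indic.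
  transitivity (\int[sigma]_z (\1_A z.1)%:E)%E.
    rewrite -[LHS]mul1e -integral_cst// integral_mkcond.
    by apply: eq_integral => z _; rewrite epatch_indic mul1e !indicE setXT.
  rewrite sE; [|exact: (measurableT_comp mA1 (@fst_borel X Y))
              |by move=> z; rewrite lee_fin].
  rewrite (@integral_fst (EFin \o \1_A))//; last by move=> x; rewrite lee_fin.
  by rewrite integral_indic// setIT.
- have mBT : measurable ([set: X] `*` B : set (borel (X * Y)%type)).
    by rewrite setTX -[X in measurable X]setTI; exact: snd_borel.
  have mB1 : measurable_fun [set: borel Y] (EFin \o (\1_B : borel Y -> R)).
    by apply/measurable_EFinP; exact: measurable_indic.
  transitivity (\int[sigma]_z (\1_B z.2)%:E)%E.
    rewrite -[LHS]mul1e -integral_cst// integral_mkcond.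
    by apply: eq_integral => z _; rewrite epatch_indic mul1e !indicE setTX.
  rewrite sE; [|exact: (measurableT_comp mB1 (@snd_borel X Y))
              |by move=> z; rewrite lee_fin].
  rewrite (@integral_snd (EFin \o \1_B))//; last by move=> x; rewrite lee_fin.
  by rewrite integral_indic// setIT.
Qed.

End MixtureCoupling.

(** Pointwise, [a * u] is at most [r * u] where [a < r] and at most [a] elsewhere. A small mass [s]
    thus costs at most [r * s] plus a tail that uniform integrability controls. *)
Lemma integral_weight_le d (T : measurableType d) (R : realType)
    (m : {measure set T -> \bar R}) (a u : T -> R) (r s : R) :
  measurable_fun setT a -> (forall x, 0 <= a x) ->
  measurable_fun setT u -> (forall x, 0 <= u x <= 1) ->
  0 <= r -> (\int[m]_x (u x)%:E = s%:E)%E ->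
  (\int[m]_x (a x * u x)%:E <=
     (r * s)%:E + \int[m]_(x in [set x | (r <= a x)%R]) (a x)%:E)%E.
Proof.
move=> ma a0 mu u01 r0 us.
pose D := [set x | r <= a x].
have mD : measurable D.
  rewrite (_ : D = a @^-1` `[r, +oo[%classic).
    by rewrite -[X in measurable X]setTI; exact: ma.
  by apply/seteqP; split=> x /=; rewrite in_itv/= andbT.
have mDi : measurable_fun setT (\1_D : T -> R) by exact: measurable_indic.
have u0 x : 0 <= u x by have /andP[] := u01 x.
have u1 x : u x <= 1 by have /andP[] := u01 x.
apply: (@le_trans _ _ (\int[m]_x ((r * u x)%:E + (a x * \1_D x)%:E))%E).
  apply: ge0_le_integral => //.
  - by move=> x _; rewrite lee_fin mulr_ge0.
  - by apply/measurable_EFinP; exact: measurable_funM.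
  - apply: emeasurable_funD; apply/measurable_EFinP.
      by apply: measurable_funM => //; exact: measurable_cst.
    exact: measurable_funM.
  move=> x _; rewrite -EFinD lee_fin indicE.
  have [_|/negP xD] := boolP (x \in D).
    by rewrite mulr1 ler_wpDl// ?mulr_ge0// ler_piMr.
  have ar : a x <= r.
    by rewrite leNgt; apply/negP => /ltW ra; apply: xD; exact: mem_set.
  by rewrite mulr0 addr0 ler_wpM2r.
rewrite ge0_integralD//; last 4 first.
- by move=> x _; rewrite lee_fin mulr_ge0.
- by apply/measurable_EFinP; apply: measurable_funM => //; exact: measurable_cst.
- by move=> x _; rewrite lee_fin mulr_ge0// indicE.
- by apply/measurable_EFinP; exact: measurable_funM.
apply: leeD.
  under eq_integral do rewrite EFinM.
  rewrite ge0_integralZl//.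
  - by rewrite us.
  - exact/measurable_EFinP.
  - by move=> x _; rewrite lee_fin.
rewrite [leRHS]integral_mkcond le_eqVlt; apply/orP; left; apply/eqP.
by apply: eq_integral => x _; rewrite epatch_indic EFinM.
Qed.

(** * Completing prescribed cell masses to a coupling *)

Section CompletedCoupling.
Context {R : realType} {X Y : ptopologicalType}.
Variables (mu : radon_probability R X) (nu : radon_probability R Y).
Hypotheses (hX : hausdorff_space X) (hY : hausdorff_space Y).
Hypothesis rX : regular_space X.
Variables (K : finType) (A : K -> borel X -> R) (B : K -> borel Y -> R).
Variables (q ma mb : K -> R).
Hypothesis mA : forall k, measurable_fun setT (A k).
Hypothesis mB : forall k, measurable_fun setT (B k).
Hypothesis A0 : forall k x, 0 <= A k x.
Hypothesis B0 : forall k y, 0 <= B k y.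
Hypothesis q0 : forall k, 0 <= q k.
Hypothesis maE : forall k, (\int[mu]_x (A k x)%:E = (ma k)%:E)%E.
Hypothesis mbE : forall k, (\int[nu]_y (B k y)%:E = (mb k)%:E)%E.
Hypothesis qma : forall k, q k * ma k = q k.
Hypothesis qmb : forall k, q k * mb k = q k.
Hypothesis qA1 : forall x, \sum_k q k * A k x <= 1.
Hypothesis qB1 : forall y, \sum_k q k * B k y <= 1.
Hypothesis q1 : \sum_k q k < 1.

Let s : R := 1 - \sum_k q k.
Let s0 : 0 < s. Proof. by rewrite /s subr_gt0. Qed.

(** Serves both marginals: [u] is the density of the part of [P] not yet used by the cells. Its
    total mass is [s] because the [k]-th cell uses exactly [q k]. *)
Let remainder (Z : ptopologicalType) (P : radon_probability R Z)
    (C : K -> borel Z -> R) (mc : K -> R) :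
  (forall k, measurable_fun setT (C k)) -> (forall k z, 0 <= C k z) ->
  (forall k, (\int[P]_z (C k z)%:E = (mc k)%:E)%E) ->
  (forall k, q k * mc k = q k) -> (forall z, \sum_k q k * C k z <= 1) ->
  let u (z : borel Z) := 1 - \sum_k q k * C k z in
  [/\ measurable_fun setT u, forall z, 0 <= u z <= 1 & (\int[P]_z (u z)%:E = s%:E)%E].
Proof.
move=> mC C0 mcE qmc qC1 u.
have mqC k : measurable_fun setT (fun z => q k * C k z).
  by apply: measurable_funM => //; exact: measurable_cst.
have mS : measurable_fun setT (fun z => \sum_k q k * C k z) by exact: measurable_sum.
have mU : measurable_fun setT u.
  by apply: measurable_funB => //; exact: measurable_cst.
have S0 z : 0 <= \sum_k q k * C k z by apply: sumr_ge0 => k _; rewrite mulr_ge0.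
have u01 z : 0 <= u z <= 1 by rewrite /u subr_ge0 qC1/= gerBl.
split=> //.
have intS : (\int[P]_z (\sum_k q k * C k z)%:E = (\sum_k q k)%:E)%E.
  under eq_integral do rewrite -sumEFin.
  rewrite ge0_integral_sum//; last 2 first.
    by move=> k; exact/measurable_EFinP.
    by move=> k z _; rewrite lee_fin mulr_ge0.
  rewrite -sumEFin; apply: eq_bigr => k _.
  under eq_integral do rewrite EFinM.
  rewrite ge0_integralZl ?lee_fin//; last 2 first.
    exact/measurable_EFinP.
    by move=> z _; rewrite lee_fin.
  by rewrite mcE -EFinM qmc.
have : (\int[P]_z ((u z)%:E + (\sum_k q k * C k z)%:E) = 1)%E.
  under eq_integral do rewrite -EFinD /u subrK.
  by rewrite integral_cst// mul1e; exact: probability_setT.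
rewrite ge0_integralD//; last 4 first.
- by move=> z _; rewrite lee_fin; have /andP[] := u01 z.
- exact/measurable_EFinP.
- by move=> z _; rewrite lee_fin.
- exact/measurable_EFinP.
rewrite intS => Eu; apply/eqP; rewrite /s EFinB; apply/eqP.
by rewrite -Eu addeK.
Qed.

(* [sigma] has density [sum_k q_k A_k(x) B_k(y) + u(x) v(y) / s] with respect to
   the product measure, [u] and [v] being what is missing to the marginals. *)
Lemma completed_coupling : exists2 sigma : radon_probability R (X * Y)%type,
  couplings mu nu sigma &
  forall (h : borel (X * Y)%type -> R) (a : borel X -> R) (b : borel Y -> R)
      (c : K -> R) (r : R),
    measurable_fun setT h -> (forall z, 0 <= h z) ->
    measurable_fun setT a -> (forall x, 0 <= a x) ->
    measurable_fun setT b -> (forall y, 0 <= b y) ->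
    (forall x y, h (x, y) <= a x + b y) ->
    (forall k x y, A k x != 0 -> B k y != 0 -> h (x, y) <= c k) ->
    (forall k, 0 <= c k) -> 0 <= r ->
    (\int[sigma]_z (h z)%:E <=
       (\sum_k q k * c k)%:E +
       ((r * s)%:E + \int[mu]_(x in [set x | (r <= a x)%R]) (a x)%:E) +
       ((r * s)%:E + \int[nu]_(y in [set y | (r <= b y)%R]) (b y)%:E))%E.
Proof.
have [pi piE] := radon_product_exists mu nu hX hY rX.
have [mu1 u1 iu1] := remainder mA A0 maE qma qA1.
have [mu2 u2 iu2] := remainder mB B0 mbE qmb qB1.
set v1 := fun x : borel X => _ in mu1 u1 iu1.
set v2 := fun y : borel Y => _ in mu2 u2 iu2.
have v10 x : 0 <= v1 x by have /andP[] := u1 x.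
have v20 y : 0 <= v2 y by have /andP[] := u2 y.
(* The index [inl tt] carries the independent remainder and [inr k] the cell [k]. The weight [q k]
   is put on the first factor, the normalisation by [s] on the second. *)
pose alpha (k : unit + K) x := if k is inr k' then q k' * A k' x else v1 x.
pose beta (k : unit + K) y := if k is inr k' then B k' y else v2 y / s.
pose la (k : unit + K) := if k is inr k' then q k' else s.
pose lb (k : unit + K) := if k is inr k' then mb k' else 1.
have malpha k : measurable_fun setT (alpha k).
  case: k => [?|k]; first exact: mu1.
  exact: (measurable_funM (@measurable_cst _ _ _ _ _ (q k)) (mA k)).
have mbeta k : measurable_fun setT (beta k).
  case: k => [?|k]; last exact: mB.
  exact: (measurable_funM mu2 (@measurable_cst _ _ _ _ _ s^-1)).
have alpha0 k x : 0 <= alpha k x by case: k => [?|k] //=; rewrite mulr_ge0.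
have beta0 k y : 0 <= beta k y.
  by case: k => [?|k] //=; rewrite divr_ge0// ltW.
have laE k : (\int[mu]_x (alpha k x)%:E = (la k)%:E)%E.
  case: k => [?|k] //=; under eq_integral do rewrite EFinM.
  rewrite ge0_integralZl ?lee_fin//; last 2 first.
    exact/measurable_EFinP.
    by move=> z _; rewrite lee_fin.
  by rewrite maE -EFinM qma.
have lbE k : (\int[nu]_y (beta k y)%:E = (lb k)%:E)%E.
  case: k => [?|k] //=; under eq_integral do rewrite EFinM.
  rewrite ge0_integralZr//; last 3 first.
    exact/measurable_EFinP.
    by move=> z _; rewrite lee_fin.
    by rewrite lee_fin invr_ge0 ltW.
  by rewrite iu2 -EFinM mulfV// gt_eqF.
have alphaT x : \sum_k alpha k x * lb k = 1.
  rewrite big_sumType/= big_const card_unit/= addr0 mulr1 /v1.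
  rewrite [X in _ + X](_ : _ = \sum_k q k * A k x) ?subrK//.
  by apply: eq_bigr => k _; rewrite mulrAC qmb.
have betaT y : \sum_k la k * beta k y = 1.
  rewrite big_sumType/= big_const card_unit/= addr0 mulrCA mulfV ?gt_eqF// mulr1.
  by rewrite /v2 subrK.
have [sigma sc sE] := mixture_coupling hX hY piE malpha mbeta alpha0 beta0
  laE lbE alphaT betaT.
exists sigma => // h a b c r mh h0 ma_ a0 mb_ b0 hab hc c0 r0.
rewrite sE; [|exact/measurable_EFinP|by move=> z; rewrite lee_fin].
rewrite big_sumType/= big_const card_unit/= adde0 -[leRHS]addeA [leRHS]addeC.
have mfst (f : borel X -> R) : measurable_fun setT f ->
    measurable_fun setT (fun z : borel (X * Y)%type => f z.1).
  by move=> mf; exact: (measurableT_comp mf (@fst_borel X Y)).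
have msnd (f : borel Y -> R) : measurable_fun setT f ->
    measurable_fun setT (fun z : borel (X * Y)%type => f z.2).
  by move=> mf; exact: (measurableT_comp mf (@snd_borel X Y)).
have prodE (f : borel X -> R) (g : borel Y -> R) :
    measurable_fun setT f -> (forall x, 0 <= f x) ->
    measurable_fun setT g -> (forall y, 0 <= g y) ->
    (\int[pi]_z (f z.1 * g z.2)%:E =
      (\int[mu]_x (f x)%:E) * \int[nu]_y (g y)%:E)%E.
  move=> mf f0 mg g0; rewrite -(integral_product piE)//.
  - exact/measurable_EFinP.
  - exact/measurable_EFinP.
have ms1 (Z : ptopologicalType) : measurable_fun [set: borel Z] (fun=> s^-1).
  exact: measurable_cst.
apply: leeD.
- have mav : measurable_fun setT (fun x => a x * v1 x) by exact: measurable_funM.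
  have mbv : measurable_fun setT (fun y => b y * v2 y) by exact: measurable_funM.
  have mv1s : measurable_fun setT (fun x => v1 x / s) by exact: measurable_funM.
  have mv2s : measurable_fun setT (fun y => v2 y / s) by exact: measurable_funM.
  have si0 : 0 <= s^-1 by rewrite invr_ge0 ltW.
  have iv1s : (\int[mu]_x (v1 x / s)%:E = 1)%E.
    under eq_integral do rewrite EFinM.
    rewrite ge0_integralZr//; last 2 first.
    + exact/measurable_EFinP.
    + by move=> z _; rewrite lee_fin.
    by rewrite iu1 -EFinM mulfV// gt_eqF.
  (* The bound [h <= a + b] splits the cost of the remainder into two products, in each of which the
     factor divided by [s] has integral one. *)
  apply: (@le_trans _ _ (\int[pi]_z ((a z.1 * v1 z.1 * (v2 z.2 / s))%:E +
                                     (v1 z.1 / s * (b z.2 * v2 z.2))%:E))%E).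
    apply: ge0_le_integral => //.
    + by move=> z _; rewrite lee_fin !mulr_ge0.
    + by apply: emeasurable_funM; apply/measurable_EFinP => //;
        apply: measurable_funM; [exact: mfst|exact: (msnd _ mv2s)].
    + by apply: emeasurable_funD; apply/measurable_EFinP; apply: measurable_funM;
        [exact: (mfst _ mav)|exact: (msnd _ mv2s)
        |exact: (mfst _ mv1s)|exact: (msnd _ mbv)].
    move=> [x y] _ /=; rewrite -EFinM -EFinD lee_fin.
    rewrite [leRHS](_ : _ = (a x + b y) * (v1 x * (v2 y / s))); last by ring.
    by apply: ler_wpM2r => //; rewrite !mulr_ge0.
  rewrite ge0_integralD//; last 4 first.
  + by move=> z _; rewrite lee_fin !mulr_ge0.
  + by apply/measurable_EFinP; apply: measurable_funM;
      [exact: (mfst _ mav)|exact: (msnd _ mv2s)].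
  + by move=> z _; rewrite lee_fin !mulr_ge0.
  + by apply/measurable_EFinP; apply: measurable_funM;
      [exact: (mfst _ mv1s)|exact: (msnd _ mbv)].
  rewrite (prodE (fun x => a x * v1 x) (fun y => v2 y / s))//; last 2 first.
  + by move=> x; rewrite mulr_ge0.
  + by move=> y; rewrite mulr_ge0.
  rewrite (prodE (fun x => v1 x / s) (fun y => b y * v2 y))//; last 2 first.
  + by move=> x; rewrite mulr_ge0.
  + by move=> y; rewrite mulr_ge0.
  rewrite iv1s mul1e (lbE (inl tt)) mule1.
  by apply: leeD; apply: integral_weight_le.
rewrite -sumEFin; apply: lee_sum => k _.
(* Write [q k * c k] as the integral of the constant [c k] against the density of the cell. The
   comparison is then pointwise, and both sides vanish off the cell. *)
have -> : (q k * c k)%:E = (\int[pi]_z (c k * (q k * A k z.1) * B k z.2)%:E)%E.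
  rewrite (prodE (fun x => c k * (q k * A k x)))//; last 2 first.
  + apply: measurable_funM => //; exact: (malpha (inr k)).
  + by move=> x; rewrite !mulr_ge0.
  under eq_integral do rewrite EFinM.
  rewrite ge0_integralZl ?lee_fin//; last 2 first.
  + by apply/measurable_EFinP; exact: (malpha (inr k)).
  + by move=> x _; rewrite lee_fin mulr_ge0.
  by rewrite (laE (inr k)) mbE -!EFinM -mulrA qmb mulrC.
apply: ge0_le_integral => //.
- by move=> z _; rewrite lee_fin !mulr_ge0.
- apply: emeasurable_funM; apply/measurable_EFinP => //.
  by apply: measurable_funM; [exact: (mfst _ (malpha (inr k)))|exact: (msnd _ (mB k))].
- apply/measurable_EFinP; apply: measurable_funM; last exact: (msnd _ (mB k)).
  by apply: measurable_funM => //; exact: (mfst _ (malpha (inr k))).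
move=> [x y] _ /=; rewrite -EFinM lee_fin -[leRHS]mulrA.
have [->|Ak] := eqVneq (A k x) 0; first by rewrite !(mulr0, mul0r).
have [->|Bk] := eqVneq (B k y) 0; first by rewrite !(mulr0, mul0r).
by apply: ler_wpM2r; [rewrite !mulr_ge0|exact: hc Ak Bk].
Qed.

End CompletedCoupling.

(** * Cells on which the cost oscillates little *)

Definition partition_on (R : realType) (X : topologicalType) (K : set X)
    (n : nat) (f : 'I_n -> X -> R) : Prop :=
  [/\ forall i, continuous (f i), forall i x, 0 <= f i x,
    forall x, \sum_i f i x <= 1 & forall x, K x -> \sum_i f i x = 1].

Lemma bump (R : realType) (X : topologicalType) (x : X) (U : set X) :
  completely_regular_space X -> nbhs x U ->
  exists g : X -> R, [/\ continuous g, forall z, 0 <= g z <= 1,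
    \forall z \near x, g z = 1 & forall z, g z != 0 -> U z].
Proof.
move=> crX; rewrite nbhsE => -[V [oV Vx] VU].
have : uniform_separator [set x] (~` V).
  by apply: crX; [exact: open_closedC|exact].
move/(@uniform_separatorP X R) => [f [cf f01 fx fV]].
(* The separating function [f] vanishes at [x] only; doubling and truncating makes [g] equal to one
   on the whole neighbourhood [f < 1/2]. *)
pose g z := Num.min 1 (2 * (1 - f z)).
exists g; split.
- move=> z; apply: (@continuous_min R X (cst 1) (fun y => 2 * (1 - f y)) z).
    exact: cvg_cst.
  by apply: cvgM; [exact: cvg_cst|apply: cvgB; [exact: cvg_cst|exact: cf]].
- move=> z; have /andP[] : 0 <= f z <= 1.
    by have := f01 (f z) (ex_intro2 _ _ z I erefl); rewrite /= in_itv.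
  rewrite /g => fz0 fz1; rewrite ge_min lexx/= le_min ler01/=.
  by rewrite mulr_ge0// subr_ge0.
- have fx0 : f x = 0 by apply: fx; exists x.
  have : nbhs (f x) [set r : R | r < 2^-1].
    rewrite fx0; apply: open_nbhs_nbhs; split; first exact: open_lt.
    by rewrite /= invr_gt0.
  move=> f_lt; have {}f_lt : nbhs x (f @^-1` [set r | r < 2^-1]) := cf x _ f_lt.
  apply: filterS f_lt => z /= fz; rewrite /g; apply/min_idPl.
  by rewrite ltW//; lra.
move=> z gz; apply: VU; apply: contrapT => nV; move/eqP: gz; apply.
have fz1 : f z = 1 by apply: fV; exists z.
by rewrite /g fz1 subrr mulr0; apply/min_idPr.
Qed.

Lemma continuous_prod (R : realType) (X : topologicalType) (n : nat)
    (F : nat -> X -> R) :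
  (forall j, (j < n)%N -> continuous (F j)) ->
  continuous (fun x => \prod_(j < n) F j x).
Proof.
elim: n => [_ x|n IHn cF x]; first by under eq_fun do rewrite big_ord0; exact: cvg_cst.
under eq_fun do rewrite big_ord_recr/=.
apply: cvgM; last exact: cF.
by apply: IHn => j jn; apply: cF; exact: ltnW.
Qed.

Lemma sum_prod_compl (R : comNzRingType) (n : nat) (G : nat -> R) :
  \sum_(i < n) G i * \prod_(j < i) (1 - G j) = 1 - \prod_(j < n) (1 - G j).
Proof.
elim: n => [|n IHn]; first by rewrite !big_ord0 subrr.
by rewrite big_ord_recr/= IHn big_ord_recr/=; ring.
Qed.

(** Take finitely many bumps [G i] such that on [K] one of them always equals one, and put
    [f i = G i * \prod_(j < i) (1 - G j)]. The sum telescopes to [1 - \prod_j (1 - G j)], which is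
    one on [K] without any division. *)
Lemma partition_of_unity (R : realType) (X : ptopologicalType) (K : set X)
    (U : X -> set X) :
  completely_regular_space X -> compact K -> (forall x, K x -> nbhs x (U x)) ->
  exists n (p : 'I_n -> X) (f : 'I_n -> X -> R), [/\ partition_on K f,
    forall i, K (p i) & forall i x, f i x != 0 -> U (p i) x].
Proof.
move=> crX cK KU.
have /choice[g gP] x : exists g : X -> R, K x -> [/\ continuous g,
    forall z, 0 <= g z <= 1, \forall z \near x, g z = 1 &
    forall z, g z != 0 -> U x z].
  have [Kx|nKx] := pselect (K x); last by exists (cst 0).
  by have [g gP] := @bump R X x (U x) crX (KU _ Kx); exists g.
move: (cK); rewrite compact_cover.
move=> /(_ X K (fun x => (interior [set z | g x z = 1]))) [].
- by move=> x _; exact: open_interior.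
- by move=> x Kx; exists x => //; have [_ _ + _] := gP _ Kx.
move=> D DK Dcov.
pose s : seq X := finmap.enum_fset D.
have sK i : (i < size s)%N -> K (nth point s i).
  by move=> /(mem_nth point) /DK; rewrite inE.
pose G i := g (nth point s i).
pose f (i : 'I_(size s)) x := G i x * \prod_(j < i) (1 - G j x).
have Gc i : (i < size s)%N -> continuous (G i).
  by move=> /sK/gP[].
have G01 i x : (i < size s)%N -> 0 <= G i x <= 1.
  by move=> /sK/gP[_ + _ _]; exact.
have sumE x : \sum_i f i x = 1 - \prod_(j < size s) (1 - G j x).
  exact: (sum_prod_compl (size s) (G ^~ x)).
exists (size s), (fun i => nth point s i), f; split.
- split.
  + move=> i x; apply: cvgM; first exact: Gc.
    apply: (@continuous_prod R X i (fun j y => 1 - G j y)) => j ji y.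
    apply: cvgB; first exact: cvg_cst.
    exact: Gc (ltn_trans ji (ltn_ord i)) y.
  + move=> i x; rewrite /f mulr_ge0//.
      by have /andP[] := G01 i x (ltn_ord i).
    apply: prodr_ge0 => j _; rewrite subr_ge0.
    by have /andP[] := G01 j x (ltn_trans (ltn_ord j) (ltn_ord i)).
  + move=> x; rewrite sumE gerBl; apply: prodr_ge0 => j _; rewrite subr_ge0.
    by have /andP[] := G01 j x (ltn_ord j).
  + move=> x /Dcov[y /= yD /interior_subset /= gy]; rewrite sumE.
    have yi : (index y s < size s)%N by rewrite index_mem.
    rewrite (bigD1 (Ordinal yi))//= /G nth_index//.
    by rewrite gy subrr mul0r subr0.
- by move=> i; exact: sK.
- move=> i x; rewrite /f mulf_eq0 negb_or => /andP[Gi _].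
  by have [_ _ _] := gP _ (sK _ (ltn_ord i)); apply.
Qed.

Lemma open_rectangle (X Y : topologicalType) (A : set X) (B : set Y) :
  open A -> open B -> open (A `*` B).
Proof.
move=> opA opB.
rewrite (_ : A `*` B = fst @^-1` A `&` snd @^-1` B)//; apply: openI.
- by apply: open_comp => // z _; exact: cvg_fst.
- by apply: open_comp => // z _; exact: cvg_snd.
Qed.

(** Continuity at [(t, z)] gives a box around [z] on which [h] varies by less than [e] for times
    near [t]; finitely many such boxes cover [K1 x K2]. The reference point is the centre of a box,
    not [(x, y)] itself. *)
Lemma small_oscillation (R : realType) (X Y : ptopologicalType)
    (T : topologicalType) (h : T -> X * Y -> R) (t : T)
    (K1 : set X) (K2 : set Y) (e : R) :
  continuous (fun p : T * (X * Y) => h p.1 p.2) -> compact K1 -> compact K2 ->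
  0 < e ->
  exists (U : X -> set X) (V : Y -> set Y), [/\ forall x, K1 x -> nbhs x (U x),
    forall y, K2 y -> nbhs y (V y) &
    forall x y, K1 x -> K2 y -> exists z, \forall t' \near t, forall x' y',
      U x x' -> V y y' -> `|h t' (x', y') - h t z| <= e].
Proof.
move=> ch cK1 cK2 e0.
have box z : exists W : set T * (set X * set Y), [/\ nbhs t W.1,
    open W.2.1 /\ open W.2.2, W.2.1 z.1 /\ W.2.2 z.2 &
    forall t' x' y', W.1 t' -> W.2.1 x' -> W.2.2 y' ->
      `|h t' (x', y') - h t z| <= e].
  have /(_ (ball (h t z) e))[] := ch (t, z); first exact: nbhsx_ballx.
  move=> [W B] /= [tW [[A1 A2] /= [zA1 zA2] AB]] WB.
  rewrite nbhsE in zA1; rewrite nbhsE in zA2.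
  have [[G1 [opG1 zG1] GA1] [G2 [opG2 zG2] GA2]] := (zA1, zA2).
  exists (W, (G1, G2)); split => //= t' x' y' Wt' G1x G2y.
  rewrite distrC; apply/ltW/(WB (t', (x', y'))); split => //=; apply: (AB (x', y')).
  by split; [exact: GA1|exact: GA2].
have {box}/choice[W WP] := box.
have := compact_setX cK1 cK2; rewrite compact_cover.
move=> /(_ (X * Y)%type (K1 `*` K2) (fun z => (W z).2.1 `*` (W z).2.2)) [].
- move=> z _; have [_ [op1 op2] _ _] := WP z; exact: open_rectangle.
- by move=> z Kz; exists z => //; have [_ _ zW _] := WP z.
move=> D _ Dcov.
(* [U x] is the intersection of those finitely many first sides that contain [x], and likewise for
   [V y]; so [U x x V y] lies in every selected box containing [(x, y)]. *)
exists (fun x => \bigcap_(z in [set` D]) [set x' | (W z).2.1 x -> (W z).2.1 x']).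
exists (fun y => \bigcap_(z in [set` D]) [set y' | (W z).2.2 y -> (W z).2.2 y']).
split.
- move=> x _; apply: filter_bigI => z _.
  have [_ [op1 _] _ _] := WP z; have [zx|nzx] := pselect ((W z).2.1 x).
    by apply: filterS (open_nbhs_nbhs (conj op1 zx)) => x' zx' _.
  by apply: filterS filterT => x' _ /nzx.
- move=> y _; apply: filter_bigI => z _.
  have [_ [_ op2] _ _] := WP z; have [zy|nzy] := pselect ((W z).2.2 y).
    by apply: filterS (open_nbhs_nbhs (conj op2 zy)) => y' zy' _.
  by apply: filterS filterT => y' _ /nzy.
move=> x y K1x K2y.
have [z /= zD [zx zy]] := Dcov (x, y) (conj K1x K2y).
exists z; have [tW _ _ hW] := WP z; apply: filterS tW => t' tW x' y' Ux Vy.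
by apply: hW => //; [exact: Ux zD zx|exact: Vy zD zy].
Qed.

Lemma small_cells (R : realType) (X Y : ptopologicalType)
    (T : topologicalType) (h : T -> X * Y -> R) (t : T)
    (K1 : set X) (K2 : set Y) (e : R) :
  completely_regular_space X -> completely_regular_space Y ->
  continuous (fun p : T * (X * Y) => h p.1 p.2) -> (forall t z, 0 <= h t z) ->
  compact K1 -> compact K2 -> 0 < e ->
  exists n m (phi : 'I_n -> X -> R) (psi : 'I_m -> Y -> R) (c : 'I_n -> 'I_m -> R),
    [/\ partition_on K1 phi, partition_on K2 psi, forall i j, 0 <= c i j &
      \forall t' \near t, forall i j x y, phi i x != 0 -> psi j y != 0 ->
        `|h t' (x, y) - c i j| <= e].
Proof.
move=> crX crY ch h0 cK1 cK2 e0.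
have [U [V [KU KV UV]]] := small_oscillation t ch cK1 cK2 e0.
have [n [p [phi [phiP pK phiU]]]] := partition_of_unity R crX cK1 KU.
have [m [r [psi [psiP rK psiV]]]] := partition_of_unity R crY cK2 KV.
have /choice[z zP] (ij : 'I_n * 'I_m) := UV _ _ (pK ij.1) (rK ij.2).
exists n, m, phi, psi, (fun i j => h t (z (i, j))); split => //.
(* There are finitely many cells, so one neighbourhood of [t] suits them all. *)
apply: filter_forall => i; apply: filter_forall => j.
apply: filterS (zP (i, j)) => t' /= hz x y phix psiy.
by apply: hz; [exact: phiU|exact: psiV].
Qed.

(** * Transfer of a coupling to nearby marginals *)

(** If some [p j] exceeds [theta], that term alone loses [theta] and the others do not grow;
    otherwise all trimmed terms vanish. *)
Lemma sum_trim_le (R : realDomainType) (J : finType) (p : J -> R) (theta : R) :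
  0 <= theta -> (forall j, 0 <= p j) ->
  \sum_j Num.max 0 (p j - theta) <= Num.max 0 (\sum_j p j - theta).
Proof.
move=> theta0 p0.
have trim_le j : Num.max 0 (p j - theta) <= p j by rewrite ge_max p0/= gerBl.
have [/existsP[j jp]|/existsPn np] := boolP [exists j, theta < p j].
  rewrite le_max; apply/orP; right.
  rewrite (bigD1 j)//= [in leRHS](bigD1 j)//= addrAC.
  by rewrite lerD// ?ler_sum// ge_max lexx subr_ge0 ltW.
rewrite big1 ?le_max ?lexx// => j _; apply/max_idPl.
by rewrite subr_le0 leNgt np.
Qed.

Lemma sum_trim_loss (R : realDomainType) (J : finType) (p : J -> R) (theta : R) :
  \sum_j p j - \sum_j Num.max 0 (p j - theta) <= #|J|%:R * theta.
Proof.
rewrite -sumrB.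
apply: (@le_trans _ _ (\sum_(j : J) theta)); last first.
  by rewrite sumr_const mulr_natl.
by apply: ler_sum => j _; rewrite lerBlDr -lerBlDl le_max lexx orbT.
Qed.

Section SourceEstimates.
Context {R : realType} {X Y : ptopologicalType}.
Variables (mu : radon_probability R X) (nu : radon_probability R Y).
Variable sigma : radon_probability R (X * Y)%type.
Hypothesis sc : couplings mu nu sigma.

Lemma integral_coupling_fst (f : borel X -> \bar R) :
  measurable_fun setT f -> (forall x, 0 <= f x)%E ->
  (\int[sigma]_z f z.1 = \int[mu]_x f x)%E.
Proof.
move=> mf f0.
transitivity (\int[pushforward sigma (fst : borel (X * Y)%type -> borel X)]_x f x)%E.
  by rewrite (ge0_integral_pushforward (@fst_borel X Y)).
apply: eq_measure_integral => [|? A mA _]; first exact: fst_borel.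
rewrite [LHS](_ : _ = sigma (A `*` setT)); first by have [+ _] := sc; apply.
by rewrite setXT.
Qed.

Lemma integral_coupling_snd (g : borel Y -> \bar R) :
  measurable_fun setT g -> (forall y, 0 <= g y)%E ->
  (\int[sigma]_z g z.2 = \int[nu]_y g y)%E.
Proof.
move=> mg g0.
transitivity (\int[pushforward sigma (snd : borel (X * Y)%type -> borel Y)]_x g x)%E.
  by rewrite (ge0_integral_pushforward (@snd_borel X Y)).
apply: eq_measure_integral => [|? A mA _]; first exact: snd_borel.
rewrite [LHS](_ : _ = sigma (setT `*` A)); first by have [_] := sc; apply.
by rewrite setTX.
Qed.

End SourceEstimates.

Lemma integral_fin_le1 d (T : measurableType d) (R : realType)
    (P : probability T R) (f : T -> R) :
  measurable_fun setT f -> (forall x, 0 <= f x <= 1) ->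
  (\int[P]_x (f x)%:E = (\int[P]_x f x)%:E)%E /\ 0 <= \int[P]_x f x <= 1.
Proof.
move=> mf f01.
have f0 x : 0 <= f x by have /andP[] := f01 x.
have I0 : (0 <= \int[P]_x (f x)%:E)%E by apply: integral_ge0 => x _; rewrite lee_fin.
have I1 : (\int[P]_x (f x)%:E <= 1)%E.
  have <- : (\int[P]_x cst 1 x = 1)%E.
    by rewrite integral_cst// mul1e; exact: probability_setT.
  apply: ge0_le_integral => //.
  - by move=> x _; rewrite lee_fin.
  - exact/measurable_EFinP.
  - by move=> x _; rewrite lee_fin; have /andP[] := f01 x.
have Ifin : (\int[P]_x (f x)%:E)%E \is a fin_num.
  by rewrite ge0_fin_numE// (le_lt_trans I1)// ltry.
rewrite /Rintegral fineK//; split=> //.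
by rewrite fine_ge0//= -lee_fin fineK.
Qed.

Lemma ge0_integral_sumEFin d (T : measurableType d) (R : realType)
    (P : {measure set T -> \bar R}) (I : finType) (F : I -> T -> R) :
  (forall k, measurable_fun setT (F k)) -> (forall k x, 0 <= F k x) ->
  (\int[P]_x (\sum_k F k x)%:E = \sum_k \int[P]_x (F k x)%:E)%E.
Proof.
move=> mF F0; under eq_integral do rewrite -sumEFin.
rewrite ge0_integral_sum//.
- by move=> k; exact/measurable_EFinP.
- by move=> k x _; rewrite lee_fin.
Qed.

Lemma partition_on_le1 (R : realType) (X : topologicalType) (K : set X) (n : nat)
    (f : 'I_n -> X -> R) i x : partition_on K f -> 0 <= f i x <= 1.
Proof.
move=> [_ f0 f1 _]; rewrite f0/=; apply: le_trans (f1 x).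
by rewrite (bigD1 i)//= lerDl sumr_ge0.
Qed.

(** * Cell masses of a coupling *)

Section CellMasses.
Context {R : realType} {X Y : ptopologicalType}.
Variables (mu : radon_probability R X) (nu : radon_probability R Y).
Variable sigma : radon_probability R (X * Y)%type.
Hypothesis sc : couplings mu nu sigma.
Hypotheses (hX : hausdorff_space X) (hY : hausdorff_space Y).
Variables (K1 : set X) (K2 : set Y).
Hypotheses (cK1 : compact K1) (cK2 : compact K2).
Variables (n m : nat) (phi : 'I_n -> X -> R) (psi : 'I_m -> Y -> R).
Hypotheses (phiP : partition_on K1 phi) (psiP : partition_on K2 psi).

Definition cell_mass (k : 'I_n * 'I_m) : R :=
  \int[sigma]_z (phi k.1 z.1 * psi k.2 z.2).

Let phi01 i x : 0 <= phi i x <= 1. Proof. exact: partition_on_le1 phiP. Qed.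
Let psi01 j y : 0 <= psi j y <= 1. Proof. exact: partition_on_le1 psiP. Qed.
Let phi0 i x : 0 <= phi i x. Proof. by have /andP[] := phi01 i x. Qed.
Let psi0 j y : 0 <= psi j y. Proof. by have /andP[] := psi01 j y. Qed.
Let mphi i : measurable_fun [set: borel X] (phi i).
Proof. by have [cphi _ _ _] := phiP; exact: continuous_borel_real. Qed.
Let mpsi j : measurable_fun [set: borel Y] (psi j).
Proof. by have [cpsi _ _ _] := psiP; exact: continuous_borel_real. Qed.

Let mcell k : measurable_fun [set: borel (X * Y)%type]
  (fun z => phi k.1 z.1 * psi k.2 z.2).
Proof.
apply: measurable_funM.
- exact: (measurableT_comp (mphi _) (@fst_borel X Y)).
- exact: (measurableT_comp (mpsi _) (@snd_borel X Y)).
Qed.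

Let cell0 (k : 'I_n * 'I_m) (z : X * Y) : 0 <= phi k.1 z.1 * psi k.2 z.2.
Proof. by rewrite mulr_ge0. Qed.

Let cell01 (k : 'I_n * 'I_m) (z : X * Y) : 0 <= phi k.1 z.1 * psi k.2 z.2 <= 1.
Proof.
have /andP[a0 a1] := phi01 k.1 z.1; have /andP[b0 b1] := psi01 k.2 z.2.
by rewrite mulr_ge0//= mulr_ile1.
Qed.

Let massE k : (\int[sigma]_z (phi k.1 z.1 * psi k.2 z.2)%:E = (cell_mass k)%:E)%E.
Proof. by have [] := integral_fin_le1 sigma (mcell k) (cell01 k). Qed.

Lemma cell_mass_ge0 k : 0 <= cell_mass k.
Proof. by have [_ /andP[]] := integral_fin_le1 sigma (mcell k) (cell01 k). Qed.

Let sum_cellE x y : \sum_(k : 'I_n * 'I_m) phi k.1 x * psi k.2 y =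
  (\sum_i phi i x) * (\sum_j psi j y).
Proof. by rewrite big_distrlr/= pair_bigA. Qed.

Let sum_cell_le1 x y : \sum_(k : 'I_n * 'I_m) phi k.1 x * psi k.2 y <= 1.
Proof.
have [_ _ phi1 _] := phiP; have [_ _ psi1 _] := psiP.
by rewrite sum_cellE mulr_ile1 ?sumr_ge0.
Qed.

Lemma sum_cell_mass_le1 : \sum_k cell_mass k <= 1.
Proof.
rewrite -lee_fin -sumEFin; under eq_bigr do rewrite -massE.
rewrite -ge0_integral_sumEFin//.
have <- : (\int[sigma]_z cst 1 z = 1)%E.
  by rewrite integral_cst// mul1e; exact: probability_setT.
apply: ge0_le_integral => //.
- by move=> z _; rewrite lee_fin sumr_ge0.
- by apply/measurable_EFinP; exact: measurable_sum.
- by move=> z _; rewrite lee_fin.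
Qed.

(** The [psi j] sum to at most one, so the row is bounded by the integral of [phi i] against the
    first marginal. *)
Lemma cell_mass_row i : \sum_j cell_mass (i, j) <= \int[mu]_x phi i x.
Proof.
have [phiE _] := integral_fin_le1 mu (mphi i) (phi01 i).
rewrite -lee_fin -sumEFin -phiE; under eq_bigr do rewrite -massE/=.
have mphiE : measurable_fun [set: borel X] (EFin \o phi i) by exact/measurable_EFinP.
rewrite -ge0_integral_sumEFin//=; last 2 first.
- by move=> j; exact: (mcell (i, j)).
- by move=> j z; exact: (cell0 (i, j)).
rewrite -(integral_coupling_fst sc mphiE); last by move=> x; rewrite lee_fin.
apply: ge0_le_integral => //.
- by move=> z _; rewrite lee_fin sumr_ge0// => j _; exact: (cell0 (i, j)).
- by apply/measurable_EFinP; apply: measurable_sum => j; exact: (mcell (i, j)).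
- exact: (measurableT_comp mphiE (@fst_borel X Y)).
move=> z _; rewrite lee_fin -mulr_sumr ler_piMr//.
by have [_ _ + _] := psiP; exact.
Qed.

Lemma cell_mass_col j : \sum_i cell_mass (i, j) <= \int[nu]_y psi j y.
Proof.
have [psiE _] := integral_fin_le1 nu (mpsi j) (psi01 j).
rewrite -lee_fin -sumEFin -psiE; under eq_bigr do rewrite -massE/=.
have mpsiE : measurable_fun [set: borel Y] (EFin \o psi j) by exact/measurable_EFinP.
rewrite -ge0_integral_sumEFin//=; last 2 first.
- by move=> i; exact: (mcell (i, j)).
- by move=> i z; exact: (cell0 (i, j)).
rewrite -(integral_coupling_snd sc mpsiE); last by move=> x; rewrite lee_fin.
apply: ge0_le_integral => //.
- by move=> z _; rewrite lee_fin sumr_ge0// => i _; exact: (cell0 (i, j)).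
- by apply/measurable_EFinP; apply: measurable_sum => i; exact: (mcell (i, j)).
- exact: (measurableT_comp mpsiE (@snd_borel X Y)).
move=> z _; rewrite lee_fin -mulr_suml ler_piMl//.
by have [_ _ + _] := phiP; exact.
Qed.

(** The cell weights sum to one on [K1 x K2], and off this set one of the indicators of the
    complements of [K1] and [K2] equals one; integrate this pointwise bound. *)
Lemma sum_cell_mass_ge (d1 d2 : R) :
  (mu (~` K1) <= d1%:E)%E -> (nu (~` K2) <= d2%:E)%E ->
  1 - \sum_k cell_mass k <= d1 + d2.
Proof.
move=> muK1 nuK2.
have mK1 : measurable (~` K1 : set (borel X)).
  by apply: measurableC; exact: compact_borel.
have mK2 : measurable (~` K2 : set (borel Y)).
  by apply: measurableC; exact: compact_borel.
have m1 : measurable_fun [set: borel X] (EFin \o (\1_(~` K1) : borel X -> R)).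
  by apply/measurable_EFinP; exact: measurable_indic.
have m2 : measurable_fun [set: borel Y] (EFin \o (\1_(~` K2) : borel Y -> R)).
  by apply/measurable_EFinP; exact: measurable_indic.
have m1' := measurableT_comp m1 (@fst_borel X Y).
have m2' := measurableT_comp m2 (@snd_borel X Y).
have mS : measurable_fun [set: borel (X * Y)%type]
    (EFin \o (fun z => \sum_k phi k.1 z.1 * psi k.2 z.2)).
  by apply/measurable_EFinP; exact: measurable_sum.
have S0 (z : X * Y) : (0 <= (\sum_k phi k.1 z.1 * psi k.2 z.2)%:E)%E.
  by rewrite lee_fin sumr_ge0.
rewrite lerBlDl -lee_fin EFinD EFinD -sumEFin; under eq_bigr do rewrite -massE.
rewrite -ge0_integral_sumEFin//.
have <- : (\int[sigma]_z cst 1 z = 1)%E.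
  by rewrite integral_cst// mul1e; exact: probability_setT.
apply: (@le_trans _ _ (\int[sigma]_z ((\sum_k phi k.1 z.1 * psi k.2 z.2)%:E +
   ((\1_(~` K1) z.1)%:E + (\1_(~` K2) z.2)%:E)))%E).
  apply: ge0_le_integral => //.
  - by apply: emeasurable_funD => //; exact: emeasurable_funD.
  move=> [x y] _ /=; rewrite -!EFinD lee_fin !indicE.
  have S0xy : 0 <= \sum_(k : 'I_n * 'I_m) phi k.1 x * psi k.2 y.
    by apply: sumr_ge0 => k _; rewrite mulr_ge0.
  have [xK|/negP nxK] := boolP (x \in ~` K1).
    by have := ler0n R (y \in ~` K2); rewrite /=; lra.
  have [yK|/negP nyK] := boolP (y \in ~` K2).
    by have := ler0n R (x \in ~` K1); rewrite /=; lra.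
  have Kx : K1 x by apply: contrapT => nK; apply: nxK; exact: mem_set.
  have Ky : K2 y by apply: contrapT => nK; apply: nyK; exact: mem_set.
  have [_ _ _ /(_ _ Kx) p1] := phiP; have [_ _ _ /(_ _ Ky) p2] := psiP.
  by rewrite sum_cellE p1 p2 mulr1 !addr0.
rewrite ge0_integralD//; last 2 first.
- by move=> z _; rewrite adde_ge0 ?lee_fin.
- exact: emeasurable_funD.
rewrite ge0_integralD//.
apply: leeD => //; apply: leeD.
- rewrite (integral_coupling_fst sc m1); last by move=> x; rewrite lee_fin.
  by rewrite integral_indic// setIT.
- rewrite (integral_coupling_snd sc m2); last by move=> x; rewrite lee_fin.
  by rewrite integral_indic// setIT.
Qed.

(** Wherever the weight of cell [k] is nonzero, [c k] is at most [h + e], and the weights sum to at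
    most one. *)
Lemma sum_cell_cost_le (h : borel (X * Y)%type -> R) (c : 'I_n * 'I_m -> R) (e : R) :
  measurable_fun setT h -> (forall z, 0 <= h z) -> (forall k, 0 <= c k) -> 0 <= e ->
  (forall k x y, phi k.1 x != 0 -> psi k.2 y != 0 -> c k <= h (x, y) + e) ->
  ((\sum_k cell_mass k * c k)%:E <= \int[sigma]_z (h z)%:E + e%:E)%E.
Proof.
move=> mh h0 c0 e0 ch.
have mck k : measurable_fun [set: borel (X * Y)%type]
    (fun z => c k * (phi k.1 z.1 * psi k.2 z.2)).
  by apply: measurable_funM => //; exact: measurable_cst.
have ck0 (k : 'I_n * 'I_m) (z : X * Y) : 0 <= c k * (phi k.1 z.1 * psi k.2 z.2).
  by rewrite mulr_ge0.
have -> : ((\sum_k cell_mass k * c k)%:E =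
    \int[sigma]_z (\sum_k c k * (phi k.1 z.1 * psi k.2 z.2))%:E)%E.
  rewrite ge0_integral_sumEFin// -sumEFin; apply: eq_bigr => k _.
  under eq_integral do rewrite EFinM.
  rewrite ge0_integralZl ?lee_fin//; last 2 first.
  - exact/measurable_EFinP.
  - by move=> z _; rewrite lee_fin.
  by rewrite massE EFinM muleC.
apply: (@le_trans _ _ (\int[sigma]_z ((h z)%:E + e%:E))%E).
  apply: ge0_le_integral => //.
  - by move=> z _; rewrite lee_fin sumr_ge0.
  - by apply/measurable_EFinP; exact: measurable_sum.
  - by apply: emeasurable_funD => //; exact/measurable_EFinP.
  move=> [x y] _ /=; rewrite -EFinD lee_fin.
  apply: (@le_trans _ _ (\sum_k (h (x, y) + e) * (phi k.1 x * psi k.2 y))).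
    apply: ler_sum => k _.
    have [->|pk] := eqVneq (phi k.1 x) 0; first by rewrite mul0r !mulr0.
    have [->|sk] := eqVneq (psi k.2 y) 0; first by rewrite !mulr0.
    by apply: ler_wpM2r; [rewrite mulr_ge0|exact: ch].
  by rewrite -mulr_sumr ler_piMr// addr_ge0.
rewrite ge0_integralD//.
- rewrite integral_cst// [X in (_ * X)%E](_ : _ = 1%E) ?mule1//.
  exact: probability_setT.
- by move=> z _; rewrite lee_fin.
- exact/measurable_EFinP.
Qed.

End CellMasses.

(** * Comparison of the optimal costs for two pairs of marginals *)

Section KantorovichTransfer.
Context {R : realType} {X Y : ptopologicalType}.
Variables (mu mu' : radon_probability R X) (nu nu' : radon_probability R Y).
Hypotheses (hX : hausdorff_space X) (hY : hausdorff_space Y).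
Hypothesis rX : regular_space X.
Variables (K1 : set X) (K2 : set Y).
Hypotheses (cK1 : compact K1) (cK2 : compact K2).
Variables (n m : nat) (phi : 'I_n -> X -> R) (psi : 'I_m -> Y -> R).
Hypotheses (phiP : partition_on K1 phi) (psiP : partition_on K2 psi).
Variables (d theta e r : R).
Hypothesis muK1 : (mu (~` K1) <= d%:E)%E.
Hypothesis nuK2 : (nu (~` K2) <= d%:E)%E.
Hypothesis theta0 : 0 < theta.
Hypothesis theta_le : (n * m)%:R * theta <= d.
Hypothesis mu_close : forall i, \int[mu]_x phi i x <= \int[mu']_x phi i x + theta.
Hypothesis nu_close : forall j, \int[nu]_y psi j y <= \int[nu']_y psi j y + theta.
Variables (h h' : borel (X * Y)%type -> R) (a : borel X -> R) (b : borel Y -> R).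
Variable c : 'I_n * 'I_m -> R.
Hypotheses (mh : measurable_fun setT h) (mh' : measurable_fun setT h').
Hypotheses (h0 : forall z, 0 <= h z) (h'0 : forall z, 0 <= h' z).
Hypotheses (ma : measurable_fun setT a) (mb : measurable_fun setT b).
Hypotheses (a0 : forall x, 0 <= a x) (b0 : forall y, 0 <= b y).
Hypothesis h'_le : forall x y, h' (x, y) <= a x + b y.
Hypotheses (c0 : forall k, 0 <= c k) (e0 : 0 <= e) (r0 : 0 <= r).
Hypothesis hc : forall k x y, phi k.1 x != 0 -> psi k.2 y != 0 ->
  `|h (x, y) - c k| <= e /\ `|h' (x, y) - c k| <= e.

Variable delta : R.
Hypothesis tails : (\int[mu']_(x in [set x | (r <= a x)%R]) (a x)%:E +
  \int[nu']_(y in [set y | (r <= b y)%R]) (b y)%:E <= delta%:E)%E.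

(* Lowering every cell mass by [theta] keeps the row and column sums below the
   cell masses of the target marginals. *)
Lemma kantorovich_le_integral (sigma : radon_probability R (X * Y)%type) :
  couplings mu nu sigma ->
  (kantorovich h' mu' nu' <=
   \int[sigma]_z (h z)%:E + (2 * e + 6 * (r * d) + delta)%:E)%E.
Proof.
move=> sc.
pose p := cell_mass sigma phi psi.
have p0 k : 0 <= p k by exact: (cell_mass_ge0 sigma phiP psiP).
pose M i := \int[mu']_x phi i x.
pose L j := \int[nu']_y psi j y.
have [cphi phi0 phi1 _] := phiP; have [cpsi psi0 psi1 _] := psiP.
have phi01 i x : 0 <= phi i x <= 1 by exact: partition_on_le1 phiP.
have psi01 j y : 0 <= psi j y <= 1 by exact: partition_on_le1 psiP.
have mphi i : measurable_fun [set: borel X] (phi i) by exact: continuous_borel_real.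
have mpsi j : measurable_fun [set: borel Y] (psi j) by exact: continuous_borel_real.
have ME i : (\int[mu']_x (phi i x)%:E = (M i)%:E)%E.
  by have [] := integral_fin_le1 mu' (mphi i) (phi01 i).
have LE j : (\int[nu']_y (psi j y)%:E = (L j)%:E)%E.
  by have [] := integral_fin_le1 nu' (mpsi j) (psi01 j).
have M0 i : 0 <= M i by have [_ /andP[]] := integral_fin_le1 mu' (mphi i) (phi01 i).
have L0 j : 0 <= L j by have [_ /andP[]] := integral_fin_le1 nu' (mpsi j) (psi01 j).
pose q k := Num.max 0 (p k - theta).
have q0 k : 0 <= q k by rewrite le_max lexx.
have qp k : q k <= p k by rewrite ge_max p0/= gerBl ltW.
have rowq i : \sum_j q (i, j) <= M i.
  apply: le_trans (sum_trim_le (ltW theta0) (fun j => p0 (i, j))) _.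
  rewrite ge_max M0/= lerBlDr; apply: le_trans (mu_close i).
  exact: (cell_mass_row sc phiP psiP).
have colq j : \sum_i q (i, j) <= L j.
  apply: le_trans (sum_trim_le (ltW theta0) (fun i => p0 (i, j))) _.
  rewrite ge_max L0/= lerBlDr; apply: le_trans (nu_close j).
  exact: (cell_mass_col sc phiP psiP).
have p1 : \sum_k p k <= 1 by exact: (sum_cell_mass_le1 sigma phiP psiP).
(* Strictness comes from [theta > 0]; it leaves a positive mass for the remainder, by which one
   divides. *)
have q1 : \sum_k q k < 1.
  apply: le_lt_trans (sum_trim_le (ltW theta0) p0) _.
  by rewrite gt_max ltr01/= ltrBlDr (le_lt_trans p1)// ltrDl.
(* At most [2 * d] is missing because [sigma] charges the complement of [K1 x K2], and at most [d]
   because each of the [n * m] cells is trimmed by [theta]. *)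
have q_loss : 1 - \sum_k q k <= 3 * d.
  have := sum_cell_mass_ge sc hX hY cK1 cK2 phiP psiP muK1 nuK2.
  have := sum_trim_loss p theta; rewrite card_prod !card_ord -/p -/q => P1 P2.
  by move: theta_le P1 P2; lra.
(* Division by zero gives zero, so [M / M] may be [0]; but if [M] vanishes then so does [q k], which
   is bounded by its row sum. *)
have qM k : q k * (M k.1 / M k.1) = q k.
  have [M1|M1] := eqVneq (M k.1) 0; last by rewrite mulfV// mulr1.
  suff -> : q k = 0 by rewrite mul0r.
  apply/eqP; rewrite eq_le q0 andbT -M1; apply: le_trans (rowq k.1).
  case: k {M1} => i j /=; rewrite (bigD1 j)//= lerDl sumr_ge0//.
have qL k : q k * (L k.2 / L k.2) = q k.
  have [L1|L1] := eqVneq (L k.2) 0; last by rewrite mulfV// mulr1.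
  suff -> : q k = 0 by rewrite mul0r.
  apply/eqP; rewrite eq_le q0 andbT -L1; apply: le_trans (colq k.2).
  case: k {L1} => i j /=; rewrite (bigD1 i)//= lerDl sumr_ge0//.
pose A (k : 'I_n * 'I_m) x := phi k.1 x / M k.1.
pose B (k : 'I_n * 'I_m) y := psi k.2 y / L k.2.
have mA k : measurable_fun [set: borel X] (A k).
  by apply: measurable_funM => //; exact: measurable_cst.
have mB k : measurable_fun [set: borel Y] (B k).
  by apply: measurable_funM => //; exact: measurable_cst.
have A0 k x : 0 <= A k x by rewrite divr_ge0.
have B0 k y : 0 <= B k y by rewrite divr_ge0.
have AE k : (\int[mu']_x (A k x)%:E = (M k.1 / M k.1)%:E)%E.
  under eq_integral do rewrite EFinM.
  rewrite ge0_integralZr ?lee_fin ?invr_ge0//; last 2 first.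
  - exact/measurable_EFinP.
  - by move=> x _; rewrite lee_fin.
  by rewrite ME.
have BE k : (\int[nu']_y (B k y)%:E = (L k.2 / L k.2)%:E)%E.
  under eq_integral do rewrite EFinM.
  rewrite ge0_integralZr ?lee_fin ?invr_ge0//; last 2 first.
  - exact/measurable_EFinP.
  - by move=> x _; rewrite lee_fin.
  by rewrite LE.
have qA1 x : \sum_k q k * A k x <= 1.
  apply: le_trans (phi1 x).
  rewrite -(pair_bigA _ (fun i j => q (i, j) * A (i, j) x))/=.
  apply: ler_sum => i _; rewrite /A/= -mulr_suml mulrCA ler_piMr//.
  have [->|Mi] := eqVneq (M i) 0; first by rewrite invr0 mulr0.
  by rewrite ler_pdivrMr ?mul1r// lt0r Mi M0.
have qB1 y : \sum_k q k * B k y <= 1.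
  apply: le_trans (psi1 y).
  rewrite -(pair_bigA _ (fun i j => q (i, j) * B (i, j) y))/= exchange_big/=.
  apply: ler_sum => j _; rewrite /B/= -mulr_suml mulrCA ler_piMr//.
  have [->|Lj] := eqVneq (L j) 0; first by rewrite invr0 mulr0.
  by rewrite ler_pdivrMr ?mul1r// lt0r Lj L0.
have [sigma' sc' bound] := completed_coupling hX hY rX mA mB A0 B0 q0 AE BE
  qM qL qA1 qB1 q1.
apply: (@le_trans _ _ (\int[sigma']_z (h' z)%:E)%E).
  by apply: ereal_inf_lbound; exists sigma'.
have h'c k x y : A k x != 0 -> B k y != 0 -> h' (x, y) <= c k + e.
  move=> Ak Bk; have [||_] := @hc k x y.
  - by apply: contra_neq Ak; rewrite /A => ->; rewrite mul0r.
  - by apply: contra_neq Bk; rewrite /B => ->; rewrite mul0r.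
  by rewrite ler_norml => /andP[_]; rewrite lerBlDl.
have ce0 k : 0 <= c k + e by rewrite addr_ge0.
apply: le_trans (bound h' a b _ r mh' h'0 ma a0 mb b0 h'_le h'c ce0 r0) _.
(* One [e] is spent in passing from [h] to the constants [c k], the other in passing from these to
   [h']. *)
have costs : ((\sum_k q k * (c k + e))%:E <= \int[sigma]_z (h z)%:E + (2 * e)%:E)%E.
  apply: (@le_trans _ _ ((\sum_k p k * c k)%:E + e%:E)%E).
    rewrite -EFinD lee_fin; under eq_bigr do rewrite mulrDr.
    rewrite big_split/= -mulr_suml lerD//.
      by apply: ler_sum => k _; rewrite ler_wpM2r.
    by rewrite ler_piMl// ltW.
  rewrite mulr_natl mulr2n EFinD addeA leeD2r//.
  apply: (sum_cell_cost_le sigma phiP psiP mh h0 c0 e0) => k x y pk sk.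
  have [] := hc pk sk; rewrite ler_norml => /andP[+ _] _; lra.
(* Each marginal contributes one such term for the remainder, whence [6 * (r * d)] in total. *)
have rs : (r * (1 - \sum_k q k) <= 3 * (r * d)) by rewrite mulrCA ler_wpM2l.
move: costs tails; move: (\int[sigma]_z _)%E (\int[mu']_(x in _) _)%E.
move: (\int[nu']_(y in _) _)%E => Ib S Ia costs IaIb.
apply: (@le_trans _ _ ((S + (2 * e)%:E) +
   ((3 * (r * d))%:E + Ia) + ((3 * (r * d))%:E + Ib))%E).
  apply: leeD; last by rewrite leeD2r// lee_fin.
  by apply: leeD => //; rewrite leeD2r// lee_fin.
rewrite (_ : 2 * e + 6 * (r * d) + delta =
  2 * e + (3 * (r * d) + (3 * (r * d) + delta))); last by lra.
rewrite !EFinD -!addeA.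
apply: leeD => //; apply: leeD => //; apply: leeD => //.
by rewrite addeCA leeD.
Qed.

(** The error does not depend on the coupling [sigma], so the infimum over [sigma] may be taken. *)
Lemma kantorovich_le : (kantorovich h' mu' nu' <=
  kantorovich h mu nu + (2 * e + 6 * (r * d) + delta)%:E)%E.
Proof.
rewrite -leeBlDr//; apply: le_ereal_inf_tmp => _ [sigma sc <-].
by rewrite leeBlDr//; exact: kantorovich_le_integral.
Qed.

End KantorovichTransfer.

(** * Finiteness of the cost and passage to the limit *)

Lemma kantorovich_fin_num (R : realType) (X Y : ptopologicalType)
    (mu : radon_probability R X) (nu : radon_probability R Y)
    (h : borel (X * Y)%type -> R) (a : borel X -> R) (b : borel Y -> R) :
  hausdorff_space X -> hausdorff_space Y -> regular_space X ->
  measurable_fun setT h -> (forall z, 0 <= h z) ->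
  (forall x, 0 <= a x) -> mu.-integrable setT (EFin \o a) ->
  (forall y, 0 <= b y) -> nu.-integrable setT (EFin \o b) ->
  (forall x y, h (x, y) <= a x + b y) ->
  kantorovich h mu nu \is a fin_num.
Proof.
move=> hX hY rX mh h0 a0 ia b0 ib hab.
have ma : measurable_fun setT a by apply/measurable_EFinP; exact: measurable_int ia.
have mb : measurable_fun setT b by apply/measurable_EFinP; exact: measurable_int ib.
(* With an empty family of cells the completed coupling is the independent one. Taking [r = 0] below
   turns the tails into the full integrals of [a] and [b], which are finite. *)
have [||||||||||||sigma sc bound] := @completed_coupling R X Y mu nu hX hY rX
  'I_0 (fun _ _ => 0) (fun _ _ => 0) (fun=> 0) (fun=> 0) (fun=> 0) => //;
  try by case.
- by move=> x; rewrite big_ord0.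
- by move=> x; rewrite big_ord0.
- by rewrite big_ord0.
have setE (Z : Type) (f : Z -> R) : (forall z, 0 <= f z) -> [set z | 0 <= f z] = setT.
  by move=> f0; apply/seteqP; split=> z //= _.
have := bound h a b (fun=> 0) 0 mh h0 ma a0 mb b0 hab.
rewrite big_ord0 mul0r !add0e !setE//.
have /fin_numPlt/andP[_ aoo] := integrable_fin_num measurableT ia.
have /fin_numPlt/andP[_ boo] := integrable_fin_num measurableT ib.
move=> /(_ _ _ _)hoo.
rewrite ge0_fin_numE.
  apply: (@le_lt_trans _ _ (\int[sigma]_z (h z)%:E)%E).
    by apply: ereal_inf_lbound; exists sigma.
  apply: le_lt_trans (hoo _ _ _) _ => //; try by case.
  exact: lte_add_pinfty.
apply: le_ereal_inf_tmp => _ [tau _ <-].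
by apply: integral_ge0 => z _; rewrite lee_fin.
Qed.

(** The Prohorov property speaks of the sequence only; a compact set adapted to the limit is added
    to the one it provides. *)
Lemma tight_with_limit (R : realType) (Z : ptopologicalType)
    (v : nat -> radon_probability R Z) (m : radon_probability R Z) (d : R) :
  hausdorff_space Z -> sequentially_prohorov R Z -> v @ \oo --> m -> 0 < d ->
  exists K : set Z, [/\ compact K, forall n, (v n (~` K) <= d%:E)%E &
    (m (~` K) <= d%:E)%E].
Proof.
move=> hZ pZ vm d0.
have [K cK KP] := pZ v m vm d d0.
have [L cL LP] := radon_tight m d0.
have cKL : compact (K `|` L) by exact: compactU.
have mono (P : radon_probability R Z) (A : set Z) : compact A -> A `<=` K `|` L ->
    (P (~` A) <= d%:E)%E -> (P (~` (K `|` L)) <= d%:E)%E.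
  move=> cA AKL; apply: le_trans; apply: le_measure; rewrite ?inE.
  - by apply: measurableC; exact: compact_borel.
  - by apply: measurableC; exact: compact_borel.
  - exact: subsetC.
exists (K `|` L); split => //.
- by move=> n; apply: (mono _ K) => //; apply/ltW/KP; exists n.
- by apply: (mono _ L) => //; exact: ltW.
Qed.

(** The weak topology is initial for [radon_integrals], and evaluation at [f] is a continuous
    projection of the space of pointwise convergence. *)
Lemma weak_cvg_integral (R : realType) (Z : ptopologicalType)
    (v : nat -> radon_probability R Z) (m : radon_probability R Z) (f : Z -> R) :
  v @ \oo --> m -> continuous f -> bounded_fun f ->
  \int[v n]_x f x @[n --> \oo] --> \int[m]_x f x.
Proof.
move=> vm cf bf.
pose g : @bounded_continuous R Z := exist _ f (conj cf bf).
have cint : {for m, continuous (@radon_integrals R Z)} by exact: initial_continuous.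
have : (@radon_integrals R Z \o v) @ \oo --> radon_integrals m.
  exact: (continuous_cvg _ cint vm).
move=> cvg_int.
have cproj := @proj_continuous {classic @bounded_continuous R Z} (fun=> R) g
  (radon_integrals m).
exact: (continuous_cvg _ cproj cvg_int).

Qed.

Theorem corollary3p6 (R : realType) (X Y : ptopologicalType)
    (T : topologicalType)
    (mu : T -> radon_probability R X) (nu : T -> radon_probability R Y)
    (h : T -> X * Y -> R) (a : T -> X -> R) (b : T -> Y -> R) :
  completely_regular_hausdorff X -> sequentially_prohorov R X ->
  completely_regular_hausdorff Y -> sequentially_prohorov R Y ->
  sequentially_continuous mu ->
  sequentially_continuous nu ->
  (forall t z, 0 <= h t z) ->
  continuous (fun p : T * (X * Y) => h p.1 p.2) ->
  (forall t, [/\ measurable_fun [set: borel X] (a t),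
                 forall x, 0 <= a t x &
                 (mu t).-integrable [set: borel X] (EFin \o a t)]) ->
  (forall t, [/\ measurable_fun [set: borel Y] (b t),
                 forall y, 0 <= b t y &
                 (nu t).-integrable [set: borel Y] (EFin \o b t)]) ->
  (forall t x y, h t (x, y) <= a t x + b t y) ->
  ereal_sup [set (\int[mu t]_(x in [set x | (r <= a t x)%R]) (a t x)%:E +
                  \int[nu t]_(y in [set y | (r <= b t y)%R]) (b t y)%:E)%E
            | t in [set: T]] @[r --> +oo] --> 0%E ->
  sequentially_continuous (fun t => kantorovich (h t) (mu t) (nu t)).
Proof.
move=> [crX hX] pX [crY hY] pY cmu cnu h0 ch ia ib hab tails u s us.
have rX : regular_space X := completely_regular_regular (R := R) crX.
have ma t : measurable_fun [set: borel X] (a t) by have [] := ia t.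
have mb t : measurable_fun [set: borel Y] (b t) by have [] := ib t.
have a0 t x : 0 <= a t x by have [] := ia t.
have b0 t y : 0 <= b t y by have [] := ib t.
have mh t : measurable_fun [set: borel (X * Y)%type] (h t).
  apply: (@continuous_borel_real R (X * Y)%type) => z.
  exact: (continuous_comp (@continuous_pair T (X * Y)%type t z) (ch (t, z))).
pose k t := kantorovich (h t) (mu t) (nu t).
have kfin t : k t \is a fin_num.
  have [? ? ia'] := ia t; have [? ? ib'] := ib t.
  exact: (kantorovich_fin_num hX hY rX (mh t) (h0 t) (a0 t) ia' (b0 t) ib' (hab t)).
(* Both inequalities come from [kantorovich_le], applied once from [s] to [u i] and once from [u i]
   to [s]. Finiteness of the costs then allows a return to real distances. *)
suff close eps : 0 < eps -> \forall i \near \oo,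
    (k (u i) <= k s + eps%:E)%E /\ (k s <= k (u i) + eps%:E)%E.
  rewrite -[X in _ --> X](fineK (kfin s)).
  apply/fine_cvgP; split; first by apply: nearW => i; exact: kfin.
  apply/cvgrPdist_le => eps /close; apply: filterS => i /=.
  rewrite -/(k _) -(fineK (kfin s)) -(fineK (kfin (u i))) -!EFinD !lee_fin => -[ui si].
  by rewrite ler_norml/=; apply/andP; split; lra.
move=> eps0.
have e0 : 0 < eps / 8 by lra.
(* The level [r] is fixed first and is valid for every [t], so the tails stay below [eps / 4]
   whichever marginals are the target. *)
have [r [r0 tailr]] : exists r, 0 <= r /\ forall t,
    (\int[mu t]_(x in [set x | (r <= a t x)%R]) (a t x)%:E +
     \int[nu t]_(y in [set y | (r <= b t y)%R]) (b t y)%:E <= (eps / 4)%:E)%E.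
  have : \forall r \near +oo, (ereal_sup [set
      (\int[mu t]_(x in [set x | (r <= a t x)%R]) (a t x)%:E +
       \int[nu t]_(y in [set y | (r <= b t y)%R]) (b t y)%:E)%E
      | t in [set: T]] < (eps / 4)%:E)%E.
    apply: (tails [set y | (y < (eps / 4)%:E)%E]).
    apply: open_nbhs_nbhs; split; first exact: open_ereal_lt_ereal.
    by rewrite /= lte_fin; lra.
  move=> near_r.
  have [r [rsup r0]] := filter_ex (filterI near_r (nbhs_pinfty_ge (num_real 0))).
  exists r; split => // t; apply: le_trans (ltW rsup).
  by apply: ereal_sup_ubound; exists t.
(* Chosen after [r] so that [6 * (r * d) <= eps / 4]; [r + 1] keeps the denominator positive when
   [r = 0]. Together with [2 * (eps / 8)] and the tails the error is at most [3/4 eps]. *)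
pose d := eps / (24 * (r + 1)).
have d0 : 0 < d by rewrite divr_gt0// mulr_gt0//; lra.
have rd : 6 * (r * d) <= eps / 4.
  have : 24 * ((r + 1) * d) = eps.
    by rewrite mulrA mulrC /d mulfVK// gt_eqF// mulr_gt0//; lra.
  by rewrite mulrDl mul1r; lra.
have [K1 [cK1 muK1 musK1]] := tight_with_limit hX pX (cmu _ _ us) d0.
have [K2 [cK2 nuK2 nusK2]] := tight_with_limit hY pY (cnu _ _ us) d0.
have [n [m [phi [psi [c [phiP psiP c0 near_c]]]]]] :=
  small_cells s crX crY ch h0 cK1 cK2 e0.
(* Chosen last, since the number of cells depends on the compact sets and hence on [d]; the
   successor avoids dividing by zero when there are no cells. *)
pose theta := d / (n * m).+1%:R.
have theta0 : 0 < theta by rewrite divr_gt0// ltr0n.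
have theta_le : (n * m)%:R * theta <= d.
  rewrite /theta mulrCA ler_piMr ?(ltW d0)//.
  by rewrite ler_pdivrMr ?ltr0n// mul1r ler_nat.
have partition_cvg (Z : ptopologicalType) (v : nat -> radon_probability R Z)
    (w : radon_probability R Z) (K : set Z) (N : nat) (f : 'I_N -> Z -> R) :
    v @ \oo --> w -> partition_on K f ->
    \forall i \near \oo, forall j, `|\int[w]_x f j x - \int[v i]_x f j x| <= theta.
  move=> vw fP; apply: filter_forall => j.
  have [cf f_ge0 _ _] := fP.
  have bf : bounded_fun (f j).
    exists 1; split; [exact: num_real|move=> B /ltW B1 x _ /=].
    apply: le_trans B1; rewrite ger0_norm//.
    by have /andP[] := partition_on_le1 j x fP.
  by have /cvgrPdist_le/(_ _ theta0) := weak_cvg_integral vw (cf j) bf.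
(* The cell estimate holds near [s], in particular at [s], so the same constants [c] serve both
   [h s] and [h (u i)]. *)
have hcell_s := nbhs_singleton near_c.
have near_mu := partition_cvg _ _ _ _ _ _ (cmu _ _ us) phiP.
have near_nu := partition_cvg _ _ _ _ _ _ (cnu _ _ us) psiP.
have near_h := us _ near_c.
apply: filterS3 near_mu near_nu near_h => i mui nui hcell_i.
have total : 2 * (eps / 8) + 6 * (r * d) + eps / 4 <= eps by lra.
have weaken x y : (x <= y + (2 * (eps / 8) + 6 * (r * d) + eps / 4)%:E ->
    x <= y + eps%:E)%E.
  by move/le_trans; apply; rewrite leeD2l// lee_fin.
split; apply: weaken.
- apply: (@kantorovich_le R X Y (mu s) (mu (u i)) (nu s) (nu (u i)) hX hY rX K1 K2
    cK1 cK2 n m phi psi phiP psiP d theta (eps / 8) r musK1 nusK2 theta0 theta_le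
    _ _ (h s) (h (u i)) (a (u i)) (b (u i)) (fun k => c k.1 k.2)) => //.
  + by move=> j; have := mui j; rewrite ler_norml => /andP[]; lra.
  + by move=> j; have := nui j; rewrite ler_norml => /andP[]; lra.
  + exact: ltW.
  + by move=> j x y pj sj; split; [exact: hcell_s|exact: hcell_i].
- apply: (@kantorovich_le R X Y (mu (u i)) (mu s) (nu (u i)) (nu s) hX hY rX K1 K2
    cK1 cK2 n m phi psi phiP psiP d theta (eps / 8) r (muK1 i) (nuK2 i) theta0 theta_le
    _ _ (h (u i)) (h s) (a s) (b s) (fun k => c k.1 k.2)) => //.
  + by move=> j; have := mui j; rewrite ler_norml => /andP[]; lra.
  + by move=> j; have := nui j; rewrite ler_norml => /andP[]; lra.
  + exact: ltW.
  + by move=> j x y pj sj; split; [exact: hcell_i|exact: hcell_s].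
Qed.
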